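(* Fix an integer $s\ge 0$. For all integers $k\ge 0$ and $n\ge 1$ define $\beta^{n,k,s}\in\mathbb{Q}V_{\mathrm{biconn}}^{n,k,s}$ by the following recursion: (i) $\beta^{1,0,s}$ is the graph consisting of a single vertex with $s$ external edges whose free ends are labeled $x_1,\dots,x_s$, with coefficient $1$ (and $\beta^{n,0,s}=0$ for $n>1$, since $V_{\mathrm{biconn}}^{n,0,s}=\emptyset$); (ii) for $k>0$, $$\beta^{n,k,s}:=\frac{1}{k+n-1}\left(\sum_{i=1}^{n-1}q_i^{c(1)}(\beta^{n-1,k,s})+\frac12\sum_{i=1}^{n}t_i(\beta^{n,k-1,s})\right),$$ where the first sum is empty when $n=1$. Then, for all fixed $n$ and $k$, $\beta^{n,k,s}=\sum_{G\in V_{\mathrm{biconn}}^{n,k,s}}\alpha_G\,G$ with $\alpha_G\in\mathbb{Q}$ and $\alpha_G>0$ for all $G\in V_{\mathrm{biconn}}^{n,k,s}$. Moreover, for every isomorphism class $\mathscr{C}\subseteq V_{\mathrm{biconn}}^{n,k,s}$, $$\sum_{G\in\mathscr{C}}\alpha_G=\frac{1}{S^{\mathscr{C}}},$$ where $S^{\mathscr{C}}$ denotes the symmetry factor of the graphs in $\mathscr{C}$.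
   Context: Graphs. A graph consists of a finite nonempty set $V$ of vertices, a finite set $K$ of ends of edges, and a partition $E$ of $K$ into two-element subsets, called edges; $E=E_{\mathrm{int}}\sqcup E_{\mathrm{ext}}$. Each end of an internal edge (element of $E_{\mathrm{int}}$) is assigned to a vertex; for each external edge (element of $E_{\mathrm{ext}}$) one end is assigned to a vertex and the other end is free. If there are $s$ external edges, their free ends carry distinct labels $x_1,\dots,x_s$. An internal edge with both ends assigned to the same vertex is a loop. Multiple edges and loops are allowed. A graph is connected if any two distinct vertices are joined by a path of internal edges (a single vertex is connected). A graph is biconnected (edge-biconnected) if it is connected and remains connected after erasing any one internal edge; in particular every graph with a single vertex is biconnected. The cyclomatic number is $k=m-n+c$, where $m=|E_{\mathrm{int}}|$, $n=|V|$ and $c$ is the number of connected components. Isomorphisms. An isomorphism of graphs is a pair of bijections $\psi_V:V\to V^*$, $\psi_K:K\to K^*$ that maps internal edges to internal edges and external edges to external edges, respects the assignment of ends to vertices (and free ends), and preserves the labels of the external edges. The symmetry factor $S^G$ is the order of the group of automorphisms $(\psi_V,\psi_K)$ of $G$; it is constant on isomorphism classes. Sets of graphs. $V^{n,k,s}$ is the set of all graphs with vertex set $\{v_1,\dots,v_n\}$, cyclomatic number $k$, and $s$ external edges whose free ends are labeled $x_1,\dots,x_s$; the vertices are ordered (labeled), while graphs that differ only by renaming the ends of edges (i.e. that are isomorphic via some $(\psi_V,\psi_K)$ with $\psi_V=\mathrm{id}$) are identified. $V_{\mathrm{biconn}}^{n,k,s}\subseteq V^{n,k,s}$ is the subset of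 biconnected graphs. An isomorphism class $\mathscr{C}\subseteq V_{\mathrm{biconn}}^{n,k,s}$ is an equivalence class under isomorphism, where $\psi_V$ may permute $v_1,\dots,v_n$. For a set $W$, $\mathbb{Q}W$ is the free $\mathbb{Q}$-vector space on $W$. Linear maps, defined on graphs $G\in V^{n,k,s}$ and extended linearly: - $t_i(G)$, $1\le i\le n$, is $G$ with one additional loop at $v_i$. - $l_{i,j}(G)$, $i\ne j$, is $G$ with one additional internal edge joining $v_i$ and $v_j$. - $s_i(G)$, $1\le i\le n$: let $\mathcal{E}_i$ be the set of all ends (of internal and external edges) assigned to $v_i$. Then $s_i(G)=\sum G_{(\mathcal{E}^{(1)},\mathcal{E}^{(2)})}$, the sum being over all ordered pairs of disjoint, possibly empty sets with $\mathcal{E}^{(1)}\cup\mathcal{E}^{(2)}=\mathcal{E}_i$, where $G_{(\mathcal{E}^{(1)},\mathcal{E}^{(2)})}$ is obtained from $G$ by adding a new vertex $v_{n+1}$, keeping the ends in $\mathcal{E}^{(1)}$ at $v_i$, and reassigning the ends in $\mathcal{E}^{(2)}$ to $v_{n+1}$. - $s_i^c(G)$ is the part of the sum $s_i(G)$ consisting of the connected graphs $G_{(\mathcal{E}^{(1)},\mathcal{E}^{(2)})}$. - $q_i^{c(1)}:=\frac12\, l_{i,n+1}\circ s_i^c$. *)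

(* Defs.v *)
From HB Require Import structures.
From mathcomp Require Import all_boot all_order all_algebra.
From mathcomp Require Import finmap.
From mathcomp.multinomials Require Import monalg.

Set Implicit Arguments.
Unset Strict Implicit.
Unset Printing Implicit Defensive.

Import Order.TTheory GRing.Theory Num.Theory.

Local Open Scope ring_scope.
Local Open Scope quotient_scope.

Definition bijb (A B : finType) (f : A -> B) : bool :=
  injectiveb f && [forall y, y \in codom f].

(* A graph with vertex set V, set of ends K and set of labels L. The placement
   sends an end to [inl v] when it is assigned to the vertex v, and to [inr l]
   when it is a free end labeled l. *)
Record gdata (V K L : finType) := GData {
  dint : {set {set K}};
  dext : {set {set K}};
  dplace : {ffun K -> V + L} }.

Definition attached (V L : Type) (p : V + L) : bool :=
  if p is inl _ then true else false.

Definition graph_axiom (V K L : finType) (d : gdata V K L) : bool :=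
  [&& (0 < #|V|)%N,
      [disjoint dint d & dext d],
      partition (dint d :|: dext d) [set: K],
      [forall e in dint d :|: dext d, #|e| == 2%N],
      [forall e in dint d, forall x in e, attached (dplace d x)],
      [forall e in dext d, #|[set x in e | attached (dplace d x)]| == 1%N] &
      [forall l : L, #|[set x : K | dplace d x == inr l]| == 1%N]].

Definition gdata_code (V K L : finType) (d : gdata V K L) :=
  (dint d, dext d, dplace d).
Definition gdata_decode (V K L : finType)
    (c : {set {set K}} * {set {set K}} * {ffun K -> V + L}) :=
  GData c.1.1 c.1.2 c.2.
Lemma gdata_codeK (V K L : finType) :
  cancel (@gdata_code V K L) (@gdata_decode V K L).
Proof. by case. Qed.
HB.instance Definition _ (V K L : finType) :=
  Finite.copy (gdata V K L) (can_type (@gdata_codeK V K L)).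

Record graph (V K L : finType) := Graph {
  gval :> gdata V K L;
  graphP : graph_axiom gval }.
HB.instance Definition _ (V K L : finType) := [isSub for @gval V K L].
HB.instance Definition _ (V K L : finType) := [Finite of graph V K L by <:].

Definition Eint (V K L : finType) (G : graph V K L) := dint G.
Definition Eext (V K L : finType) (G : graph V K L) := dext G.
Definition place (V K L : finType) (G : graph V K L) : K -> V + L := dplace G.

Definition adj (V K L : finType) (G : graph V K L) (F : {set {set K}}) : rel V :=
  fun u v => [exists e in F, exists x in e, exists y in e,
    [&& x != y, place G x == inl u & place G y == inl v]].

Definition connected_by (V K L : finType) (G : graph V K L)
    (F : {set {set K}}) : bool :=
  [forall u, forall v, connect (adj G F) u v].

Definition connected (V K L : finType) (G : graph V K L) : bool :=
  connected_by G (Eint G).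

Definition biconnected (V K L : finType) (G : graph V K L) : bool :=
  connected G && [forall e in Eint G, connected_by G (Eint G :\ e)].

Definition ncomp (V K L : finType) (G : graph V K L) : nat :=
  n_comp (adj G (Eint G)) predT.

Definition cyclomatic (V K L : finType) (G : graph V K L) : int :=
  #|Eint G|%:Z - #|V|%:Z + (ncomp G)%:Z.

Definition map_place (V V' L : Type) (f : V -> V') (p : V + L) : V' + L :=
  match p with inl v => inl (f v) | inr l => inr l end.

Definition is_iso (V V' K K' L : finType) (G : graph V K L) (H : graph V' K' L)
    (psiV : V -> V') (psiK : K -> K') : bool :=
  [&& bijb psiV, bijb psiK,
      [set psiK @: (e : {set K}) | e in Eint G] == Eint H,
      [set psiK @: (e : {set K}) | e in Eext G] == Eext H &
      [forall x, place H (psiK x) == map_place psiV (place G x)]].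

Definition isomorphic (V V' K K' L : finType)
    (G : graph V K L) (H : graph V' K' L) : bool :=
  [exists psi : {ffun V -> V'} * {ffun K -> K'}, is_iso G H psi.1 psi.2].

Definition same_upto_ends (V K K' L : finType)
    (G : graph V K L) (H : graph V K' L) : bool :=
  [exists psiK : {ffun K -> K'}, is_iso G H id psiK].

Definition symmetry_factor (V K L : finType) (G : graph V K L) : nat :=
  #|[set psi : {ffun V -> V} * {ffun K -> K} | is_iso G G psi.1 psi.2]|.

Lemma bijbP (A B : finType) (f : A -> B) : reflect (bijective f) (bijb f).
Proof.
apply: (iffP andP) => [[/injectiveP fI /forallP fS]|fB].
  exists (fun y => iinv (fS y)) => x; last exact: f_iinv.
  by apply: fI; rewrite f_iinv.
split; first by apply/injectiveP/bij_inj.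
by case: fB => g fK gK; apply/forallP => y; rewrite -(gK y) codom_f.
Qed.

Lemma map_place_id (V L : Type) (p : V + L) : map_place id p = p.
Proof. by case: p. Qed.

Lemma attached_map (V V' L : Type) (f : V -> V') (p : V + L) :
  attached (map_place f p) = attached p.
Proof. by case: p. Qed.

Lemma is_iso_id (V K L : finType) (G : graph V K L) : is_iso G G id id.
Proof.
have E (X : {set {set K}}) : [set id @: (e : {set K}) | e in X] = X.
  by rewrite -[RHS]imset_id; apply: eq_imset => e; rewrite imset_id.
have bid (T : finType) : bijb (@id T) by apply/bijbP; exists id.
rewrite /is_iso !E !eqxx !bid /=.
by apply/forallP => x; rewrite map_place_id.
Qed.

Lemma eq_is_iso (V V' K K' L : finType) (G : graph V K L) (H : graph V' K' L)
    f f' g g' : f =1 f' -> g =1 g' -> is_iso G H f g = is_iso G H f' g'.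
Proof.
move=> ff gg; rewrite /is_iso.
have eqb (A B : finType) (h h' : A -> B) : h =1 h' -> bijb h = bijb h'.
  by move=> hh; apply/bijbP/bijbP => hB; apply: (eq_bij hB) => x; rewrite hh.
rewrite (eqb _ _ _ _ ff) (eqb _ _ _ _ gg).
rewrite !(eq_imset _ (fun e : {set K} => eq_imset e gg)).
do 4!congr andb; apply: eq_forallb => x; rewrite gg.
by case: (place G x) => //= v; rewrite ff.
Qed.

Lemma is_iso_comp (V V' V'' K K' K'' L : finType) (G : graph V K L)
    (G' : graph V' K' L) (G'' : graph V'' K'' L) f g f' g' :
  is_iso G G' f g -> is_iso G' G'' f' g' -> is_iso G G'' (f' \o f) (g' \o g).
Proof.
case/and5P=> /bijbP bf /bijbP bg /eqP Ei /eqP Ee /forallP P.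
case/and5P=> /bijbP bf' /bijbP bg' /eqP Ei' /eqP Ee' /forallP P'.
apply/and5P; split; try (apply/bijbP; exact: bij_comp).
- rewrite -Ei' -Ei -imset_comp; apply/eqP/eq_imset => e /=.
  by rewrite imset_comp.
- rewrite -Ee' -Ee -imset_comp; apply/eqP/eq_imset => e /=.
  by rewrite imset_comp.
apply/forallP => x /=; rewrite (eqP (P' _)) (eqP (P x)).
by case: (place G x).
Qed.

Lemma is_iso_inv (V V' K K' L : finType) (G : graph V K L) (G' : graph V' K' L)
    f g f' g' : cancel f f' -> cancel f' f -> cancel g g' -> cancel g' g ->
  is_iso G G' f g -> is_iso G' G f' g'.
Proof.
move=> fK fK' gK gK' /and5P[_ _ /eqP Ei /eqP Ee /forallP P].
have E (X : {set {set K}}) : [set g' @: (e : {set K'}) |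
    e in [set g @: (e : {set K}) | e in X]] = X.
  rewrite -imset_comp -[RHS]imset_id; apply: eq_imset => e /=.
  by rewrite -imset_comp -[RHS]imset_id; apply: eq_imset.
apply/and5P; split.
- by apply/bijbP; exists f.
- by apply/bijbP; exists g.
- by rewrite -Ei E.
- by rewrite -Ee E.
apply/forallP => x; rewrite -{2}(gK' x) (eqP (P _)).
by case: (place G _) => //= v; rewrite fK.
Qed.

(* Transport of a graph along a bijection of the set of ends. *)
Definition relabel_data (V K K' L : finType) (f : K -> K') (g : K' -> K)
    (d : gdata V K L) : gdata V K' L :=
  GData [set f @: (e : {set K}) | e in dint d]
        [set f @: (e : {set K}) | e in dext d]
        [ffun x => dplace d (g x)].

Lemma relabel_axiom (V K K' L : finType) (f : K -> K') (g : K' -> K)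
    (fK : cancel f g) (gK : cancel g f) (G : graph V K L) :
  graph_axiom (relabel_data f g G).
Proof.
have fI := can_inj fK; have fsI := imset_inj fI.
case/and5P: (graphP G) => V0 dE pE cE /and3P[iE eE lE].
rewrite /graph_axiom /relabel_data /= V0 /=.
apply/and5P; split; [| | | |apply/andP; split].
- by rewrite -setI_eq0 -imsetI ?imset_eq0 ?setI_eq0 // => ? ? _ _; apply: fsI.
- rewrite -imsetU; have -> : [set: K'] = f @: [set: K].
    by apply/setP => x; rewrite -(gK x) !inE imset_f ?inE.
  by rewrite imset_partition.
- rewrite -imsetU; apply/forall_inP => _ /imsetP[e eG ->].
  by rewrite card_imset // (forall_inP cE).
- apply/forall_inP => _ /imsetP[e eG ->].
  apply/forall_inP => _ /imsetP[x xe ->]; rewrite ffunE fK.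
  by rewrite (forall_inP (forall_inP iE _ eG)).
- apply/forall_inP => _ /imsetP[e eG ->].
  rewrite -(eqP (forall_inP eE _ eG)) -(card_imset _ fI); apply/eqP/eq_card => y.
  by rewrite -(gK y) !inE ffunE fK !mem_imset // inE.
apply/forallP => l; rewrite -(eqP (forallP lE l)) -(card_imset _ fI).
apply/eqP/eq_card => y.
by rewrite -(gK y) !inE ffunE fK !mem_imset // inE.
Qed.

Definition relabel (V K K' L : finType) (f : K -> K') (g : K' -> K)
    (fK : cancel f g) (gK : cancel g f) (G : graph V K L) : graph V K' L :=
  Graph (relabel_axiom fK gK G).

Lemma relabel_iso (V K K' L : finType) (f : K -> K') (g : K' -> K)
    (fK : cancel f g) (gK : cancel g f) (G : graph V K L) :
  is_iso G (relabel fK gK G) id f.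
Proof.
rewrite /is_iso !eqxx /=; apply/and3P; split.
- by apply/bijbP; exists id.
- by apply/bijbP; exists g.
by apply/forallP => x; rewrite map_place_id /place /= ffunE fK.
Qed.

(* Every graph is, up to renaming of its ends, a graph whose set of ends is
   some 'I_N; the type [lgraph n s] collects these, for all N. *)
Definition lgraph (n s : nat) := {N : nat & graph 'I_n 'I_N 'I_s}.

Definition lgraph_eq (n s : nat) : rel (lgraph n s) :=
  fun G H => same_upto_ends (tagged G) (tagged H).

Lemma same_upto_endsP (V K K' L : finType)
    (G : graph V K L) (H : graph V K' L) :
  reflect (exists g : K -> K', is_iso G H id g) (same_upto_ends G H).
Proof.
apply: (iffP existsP) => -[g gP]; first by exists g.
exists (finfun g); rewrite -(eq_is_iso G H (fun=> erefl) (g := g)) // => x.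
by rewrite ffunE.
Qed.

Lemma same_upto_ends_refl (V K L : finType) (G : graph V K L) :
  same_upto_ends G G.
Proof. by apply/same_upto_endsP; exists id; apply: is_iso_id. Qed.

Lemma same_upto_ends_trans (V K K' K'' L : finType) (G : graph V K L)
    (G' : graph V K' L) (G'' : graph V K'' L) :
  same_upto_ends G G' -> same_upto_ends G' G'' -> same_upto_ends G G''.
Proof.
move=> /same_upto_endsP[g gP] /same_upto_endsP[h hP].
by apply/same_upto_endsP; exists (h \o g); apply: (is_iso_comp gP hP).
Qed.

Lemma same_upto_ends_sym (V K K' L : finType) (G : graph V K L)
    (G' : graph V K' L) : same_upto_ends G G' -> same_upto_ends G' G.
Proof.
move=> /same_upto_endsP[g gP]; have /and5P[_ /bijbP[h gK hK] _ _ _] := gP.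
by apply/same_upto_endsP; exists h; apply: (is_iso_inv _ _ gK hK gP).
Qed.

Lemma lgraph_eq_refl (n s : nat) : reflexive (@lgraph_eq n s).
Proof. by move=> G; apply: same_upto_ends_refl. Qed.
Lemma lgraph_eq_sym (n s : nat) : symmetric (@lgraph_eq n s).
Proof. by move=> G H; apply/idP/idP; apply: same_upto_ends_sym. Qed.
Lemma lgraph_eq_trans (n s : nat) : transitive (@lgraph_eq n s).
Proof. by move=> G H I; apply: same_upto_ends_trans. Qed.

Canonical lgraph_equiv (n s : nat) := EquivRel (@lgraph_eq n s)
  (@lgraph_eq_refl n s) (@lgraph_eq_sym n s) (@lgraph_eq_trans n s).

(* Graphs with vertices 'I_n and external labels 'I_s, where graphs that differ
   only by the names of the ends are identified. *)
Definition vgraph (n s : nat) := {eq_quot @lgraph_eq n s}.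
HB.instance Definition _ (n s : nat) := Choice.on (vgraph n s).
HB.instance Definition _ (n s : nat) := EqQuotient.on (vgraph n s).

Definition gclass (n s : nat) (K : finType) (G : graph 'I_n K 'I_s) :
    vgraph n s :=
  \pi_(vgraph n s) (Tagged (fun N => graph 'I_n 'I_N 'I_s)
    (relabel (@enum_rankK K) (@enum_valK K) G)).

Definition grepr (n s : nat) (x : vgraph n s) :
  graph 'I_n 'I_(tag (repr x)) 'I_s := tagged (repr x).

Lemma gclass_eq (n s : nat) (K K' : finType) (G : graph 'I_n K 'I_s)
    (H : graph 'I_n K' 'I_s) : gclass G = gclass H <-> same_upto_ends G H.
Proof.
have relP (T : finType) (I : graph 'I_n T 'I_s) :
    same_upto_ends I (relabel (@enum_rankK T) (@enum_valK T) I).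
  by apply/same_upto_endsP; eexists; apply: relabel_iso.
split=> [/eqmodP /= GH|GH]; last apply/eqmodP => /=.
  apply: same_upto_ends_trans (relP _ G) _.
  by apply: same_upto_ends_trans GH _; apply: same_upto_ends_sym.
apply: same_upto_ends_trans (same_upto_ends_sym (relP _ G)) _.
exact: same_upto_ends_trans GH (relP _ H).
Qed.

Lemma greprK (n s : nat) (x : vgraph n s) : gclass (grepr x) = x.
Proof.
rewrite -[RHS]reprK; apply/eqmodP => /=; apply: same_upto_ends_sym.
by apply/same_upto_endsP; eexists; apply: relabel_iso.
Qed.

Lemma gclassK (n s : nat) (K : finType) (G : graph 'I_n K 'I_s) :
  same_upto_ends (grepr (gclass G)) G.
Proof. by apply/gclass_eq; rewrite greprK. Qed.

(* One additional internal edge joining u and v (a loop if u = v); its ends are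
   [inr true], at u, and [inr false], at v. *)
Definition add_edge_data (V K L : finType) (u v : V) (d : gdata V K L) :
    gdata V (K + bool)%type L :=
  GData ([set inr true; inr false] |: [set inl @: (e : {set K}) | e in dint d])
        [set inl @: (e : {set K}) | e in dext d]
        [ffun x => match x with
                   | inl y => dplace d y
                   | inr b => inl (if b then u else v)
                   end].

Lemma add_edge_axiom (V K L : finType) (u v : V) (G : graph V K L) :
  graph_axiom (add_edge_data u v G).
Proof.
have fI : injective (@inl K bool) by move=> x y [].
have fsI := imset_inj fI.
have e0 (e : {set K}) :
    ([set inr true; inr false] == inl @: e :> {set K + bool}) = false.
  apply/negP => /eqP /setP /(_ (inr true)); rewrite !inE /= => /esym.
  by move/imsetP => [].
case/and5P: (graphP G) => V0 dE pE cE /and3P[iE eE lE].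
rewrite /graph_axiom /add_edge_data /= V0 /= -setUA -imsetU.
apply/and5P; split; [| | | |apply/andP; split].
- rewrite -setI_eq0 setIUl setU_eq0 -imsetI; last by move=> ? ? _ _; apply: fsI.
  rewrite imset_eq0 [X in _ && X]setI_eq0 dE andbT setI_eq0 disjoints1.
  by apply/negP => /imsetP[e _ /eqP]; rewrite e0.
- have -> : [set: K + bool] = [set inr true; inr false] :|: inl @: [set: K].
    apply/setP => -[x|[]]; rewrite !inE ?eqxx //=.
    by rewrite imset_f ?inE.
  apply: partitionU1; first by rewrite imset_partition.
    by apply/set0Pn; exists (inr true); rewrite !inE.
  rewrite -setI_eq0; apply/eqP/setP => -[x|b]; rewrite !inE //=.
  by apply/negP => /andP[_ /imsetP[]].
- apply/forall_inP => e; rewrite in_setU1 => /orP[/eqP->|/imsetP[f fG ->]].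
    by rewrite cards2.
  by rewrite card_imset // (forall_inP cE).
- apply/forall_inP => e; rewrite in_setU1 => /orP[/eqP->|/imsetP[f fG ->]].
    by apply/forall_inP => -[x|b]; rewrite !inE // ffunE.
  apply/forall_inP => _ /imsetP[x xe ->]; rewrite ffunE.
  by rewrite (forall_inP (forall_inP iE _ fG)).
- apply/forall_inP => _ /imsetP[e eG ->].
  rewrite -(eqP (forall_inP eE _ eG)) -(card_imset _ fI); apply/eqP/eq_card.
  move=> [x|b]; rewrite !inE ffunE.
    by rewrite !mem_imset // inE.
  by apply/idP/imsetP => [/andP[/imsetP[]]|[]].
apply/forallP => l; rewrite -(eqP (forallP lE l)) -(card_imset _ fI).
apply/eqP/eq_card => -[x|b]; rewrite !inE ffunE.
  by rewrite !mem_imset // inE.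
by apply/idP/imsetP => [|[]].
Qed.

Definition add_edge (V K L : finType) (u v : V) (G : graph V K L) :
  graph V (K + bool)%type L := Graph (add_edge_axiom u v G).

Definition ends_at (V K L : finType) (G : graph V K L) (v : V) : {set K} :=
  [set x | place G x == inl v].

Definition old_vertex (n : nat) (i : 'I_n) : 'I_n.+1 := widen_ord (leqnSn n) i.

(* G with a new vertex, [ord_max], to which the ends of D are reassigned; the
   other ends stay where they are. D is meant to be a subset of the ends
   assigned to a given vertex; free ends are not affected. *)
Definition split_data (n : nat) (K L : finType) (D : {set K})
    (d : gdata 'I_n K L) : gdata 'I_n.+1 K L :=
  GData (dint d) (dext d)
    [ffun x => map_place (fun v => if x \in D then ord_max else old_vertex v)
                         (dplace d x)].

Lemma split_axiom (n : nat) (K L : finType) (D : {set K})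
  (G : graph 'I_n K L) : graph_axiom (split_data D G).
Proof.
case/and5P: (graphP G) => V0 dE pE cE /and3P[iE eE lE].
apply/and5P; split=> //=; first by rewrite card_ord.
apply/and3P; split.
- apply/forall_inP => e eG; apply/forall_inP => x xe.
  by rewrite ffunE attached_map (forall_inP (forall_inP iE _ eG)).
- apply/forall_inP => e eG; rewrite -(eqP (forall_inP eE _ eG)).
  by apply/eqP/eq_card => x; rewrite !inE ffunE attached_map.
apply/forallP => l; rewrite -(eqP (forallP lE l)).
by apply/eqP/eq_card => x; rewrite !inE ffunE; case: (dplace G x).
Qed.

Definition split_vertex (n : nat) (K L : finType) (D : {set K})
  (G : graph 'I_n K L) : graph 'I_n.+1 K L := Graph (split_axiom D G).

(* One vertex and, for each label l, an external edge with ends [inl l], at the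
   vertex, and [inr l], free with label l. *)
Definition star_data (L : finType) : gdata 'I_1 (L + L)%type L :=
  GData set0 [set [set inl l; inr l] | l : L]
    [ffun x => match x with inl _ => inl ord0 | inr l => inr l end].

Lemma star_axiom (L : finType) : graph_axiom (star_data L).
Proof.
apply/and5P; split; rewrite /= ?set0U ?card_ord //.
- by rewrite -setI_eq0 set0I.
- apply/and3P; split.
  + apply/eqP/setP => x; rewrite in_setT; apply/bigcupP.
    by case: x => l; exists [set inl l; inr l];
      rewrite ?set21 ?set22 //; apply: imset_f.
  + apply/trivIsetP => _ _ /imsetP[l _ ->] /imsetP[m _ ->] lm.
    have {}lm : l != m by apply: contraNneq lm => ->.
    rewrite -setI_eq0; apply/eqP/setP => -[] x; rewrite !inE /= ?orbF.
      by apply/negP => /andP[/eqP[->] /eqP[]]; apply/eqP.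
    by apply/negP => /andP[/eqP[->] /eqP[]]; apply/eqP.
  + by apply/imsetP => -[l _ /setP /(_ (inl l))]; rewrite !inE eqxx.
- by apply/forall_inP => _ /imsetP[l _ ->]; rewrite cards2.
apply/and3P; split.
- by apply/forall_inP => e; rewrite inE.
- apply/forall_inP => _ /imsetP[l _ ->]; apply/cards1P; exists (inl l).
  by apply/setP => -[] x; rewrite !inE ffunE /= ?orbF ?andbT ?andbF.
apply/forallP => l; apply/cards1P; exists (inr l).
by apply/setP => -[] x; rewrite !inE ffunE.
Qed.

Definition star (L : finType) : graph 'I_1 (L + L)%type L :=
  Graph (star_axiom L).

(* [Vset n k s] is exactly the set of graphs with cyclomatic number k, see
   [in_Vset]: such a graph has at most 2 (n + k + s) ends. *)
Definition bounded_graphs (n s N : nat) : {fset vgraph n s} :=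
  [fset x in flatten [seq [seq gclass G | G : graph 'I_n 'I_m 'I_s]
                     | m <- iota 0 N.+1]]%fset.

Definition Vset (n k s : nat) : {fset vgraph n s} :=
  [fset x in bounded_graphs n s (2 * (n + k + s))%N |
     cyclomatic (grepr x) == k%:Z]%fset.

Lemma card_Eext (V K L : finType) (G : graph V K L) : (#|Eext G| <= #|L|)%N.
Proof.
case/and5P: (graphP G) => V0 dE pE cE /and3P[iE eE lE].
have tP := partition_trivIset pE.
pose h l := if [pick x | dplace G x == inr l] is Some x
  then pblock (dint G :|: dext G) x else set0.
rewrite -cardsT; apply: leq_trans (leq_imset_card h [set: L]).
apply: subset_leq_card.
apply/subsetP => e eG.
have eU : e \in dint G :|: dext G by rewrite inE eG orbT.
have [x xe] : exists2 x, x \in e & ~~ attached (dplace G x).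
  apply/exists_inP; apply: contraT; rewrite negb_exists_in => /forall_inP aP.
  have := eqP (forall_inP eE _ eG).
  have -> : [set x in e | attached (dplace G x)] = e.
    by apply/setP => x; rewrite inE; case xe: (x \in e) => //=;
       move: (aP x xe); rewrite negbK.
  by rewrite (eqP (forall_inP cE _ eU)).
case E: (dplace G x) => [//|l] _; apply/imsetP; exists l; rewrite ?inE //.
rewrite /h; case: pickP => [y /eqP Ey|/(_ x)]; last by rewrite E eqxx.
suff -> : y = x by rewrite (def_pblock tP eU xe).
have /cards1P[z /setP lz] := forallP lE l.
have := lz x; have := lz y; rewrite !inE E Ey !eqxx.
by move=> /esym/eqP -> /esym/eqP.
Qed.

Lemma card_ends (V K L : finType) (G : graph V K L) :
  #|K| = ((#|Eint G| + #|Eext G|) * 2)%N.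
Proof.
case/and5P: (graphP G) => V0 dE pE cE _.
rewrite -cardsT (card_uniform_partition (n := 2%N) _ pE).
  have dE0 : dint G :&: dext G = set0 by apply/eqP; rewrite setI_eq0.
  by rewrite cardsU dE0 cards0 subn0.
by move=> e eG; apply/eqP/(forall_inP cE).
Qed.

Lemma is_iso_adj (V V' K K' L : finType) (G : graph V K L) (H : graph V' K' L)
    f g (F : {set {set K}}) u v : is_iso G H f g ->
  adj H [set g @: (e : {set K}) | e in F] (f u) (f v) = adj G F u v.
Proof.
case/and5P=> /bijbP/bij_inj fI /bijbP bg _ _ /forallP P; have gI := bij_inj bg.
have gP x w : (place H (g x) == inl (f w)) = (place G x == inl w).
  rewrite (eqP (P x)); case: (place G x) => //= w'.
  by apply/eqP/eqP => [[/fI->]|[->]].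
apply/exists_inP/exists_inP => -[e eF /exists_inP[x xe /exists_inP[y ye]]].
  case/imsetP: eF => e' eF Ee; rewrite Ee in xe ye.
  case/imsetP: xe ye => x' xe -> /imsetP[y' ye ->].
  rewrite !gP (inj_eq gI) => xyP; exists e' => //.
  by apply/exists_inP; exists x' => //; apply/exists_inP; exists y'.
move=> xyP; exists (g @: e); first exact: imset_f.
apply/exists_inP; exists (g x); first exact: imset_f.
by apply/exists_inP; exists (g y); rewrite ?imset_f // !gP (inj_eq gI).
Qed.

Lemma same_cyclomatic (V K K' L : finType) (G : graph V K L)
  (H : graph V K' L) : same_upto_ends G H -> cyclomatic G = cyclomatic H.
Proof.
case/same_upto_endsP => g gP; have /and5P[_ /bijbP bg /eqP Ei _ _] := gP.
rewrite /cyclomatic /ncomp -Ei (card_imset _ (imset_inj (bij_inj bg))).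
congr (_ + Posz _); apply: eq_n_comp; apply: eq_connect => u v.
by rewrite -(is_iso_adj _ _ _ gP).
Qed.

Lemma gclass_bounded (n s N : nat) (K : finType) (G : graph 'I_n K 'I_s) :
  (#|K| <= N)%N -> gclass G \in bounded_graphs n s N.
Proof.
move=> KN; rewrite /bounded_graphs in_fset; apply/flattenP.
exists [seq gclass H | H : graph 'I_n 'I_#|K| 'I_s].
  by apply/mapP; exists #|K| => //; rewrite mem_iota.
apply/mapP; exists (relabel (@enum_rankK K) (@enum_valK K) G).
  by rewrite mem_enum.
by apply/gclass_eq/same_upto_endsP; eexists; apply: relabel_iso.
Qed.

Lemma in_Vset (n k s : nat) (x : vgraph n s) :
  (x \in Vset n k s) = (cyclomatic (grepr x) == k%:Z).
Proof.
rewrite in_fset inE andb_idl // => /eqP cx.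
suff: x \in bounded_graphs n s (2 * (n + k + s))%N by [].
rewrite -[x]greprK.
apply: gclass_bounded; rewrite (card_ends (grepr x)) mulnC leq_mul2l /=.
apply: leq_add; last by rewrite -[X in (_ <= X)%N]card_ord; apply: card_Eext.
move: cx; rewrite /cyclomatic card_ord => cx.
by rewrite -lez_nat PoszD -cx [X in _ <= X]addrC addrAC subrK lerDl.
Qed.

Definition Vbiconn (n k s : nat) : {fset vgraph n s} :=
  [fset x in Vset n k s | biconnected (grepr x)]%fset.

Definition iso_class (n k s : nat) (x : vgraph n s) : {fset vgraph n s} :=
  [fset y in Vbiconn n k s | isomorphic (grepr x) (grepr y)]%fset.

Definition is_iso_class (n k s : nat) (C : {fset vgraph n s}) : Prop :=
  exists2 x, x \in Vbiconn n k s & C = iso_class k x.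

(* The free rational vector space on T is [{malg rat[T]}], the type of finitely
   supported functions from T to rat. *)
Definition linext (A B : choiceType) (f : A -> {malg rat[B]})
    (g : {malg rat[A]}) : {malg rat[B]} :=
  \sum_(x <- msupp g) g@_x *: f x.

Definition t_op (n s : nat) (i : 'I_n) :
    {malg rat[vgraph n s]} -> {malg rat[vgraph n s]} :=
  linext (fun x => << gclass (add_edge i i (grepr x)) >>).

Definition l_op (n s : nat) (i j : 'I_n) :
    {malg rat[vgraph n s]} -> {malg rat[vgraph n s]} :=
  linext (fun x => << gclass (add_edge i j (grepr x)) >>).

(* E = (E1, E2) with E1 and E2 disjoint, possibly empty, and with union the set
   of ends assigned to the vertex i. *)
Definition distribution (V K L : finType) (G : graph V K L) (i : V)
    (E : {set K} * {set K}) : bool :=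
  [disjoint E.1 & E.2] && (E.1 :|: E.2 == ends_at G i).

Definition sc_graph (n s : nat) (K : finType) (i : 'I_n)
    (G : graph 'I_n K 'I_s) : {malg rat[vgraph n.+1 s]} :=
  \sum_(E : {set K} * {set K} |
        distribution G i E && connected (split_vertex E.2 G))
     << gclass (split_vertex E.2 G) >>.

Definition sc_op (n s : nat) (i : 'I_n) :
    {malg rat[vgraph n s]} -> {malg rat[vgraph n.+1 s]} :=
  linext (fun x => sc_graph i (grepr x)).

Definition qc_op (n s : nat) (i : 'I_n) (g : {malg rat[vgraph n s]}) :
    {malg rat[vgraph n.+1 s]} :=
  2^-1 *: l_op (old_vertex i) ord_max (sc_op i g).

(* Only the values of [beta s k n] with n > 0 are meaningful. *)
Fixpoint beta (s k : nat) : forall n, {malg rat[vgraph n s]} :=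
  match k with
  | 0%N => fun n =>
      match n with
      | 1%N => << gclass (star 'I_s) >>
      | _ => 0
      end
  | k'.+1 =>
      fix beta_k n : {malg rat[vgraph n s]} :=
        match n with
        | 0%N => 0
        | n'.+1 =>
            ((k'.+1 + n'.+1 - 1)%N%:R)^-1 *:
              (\sum_(i < n') qc_op i (beta_k n') +
               2^-1 *: \sum_(i < n'.+1) t_op i (beta s k' n'.+1))
        end
  end.

Lemma beta_rec (s k n : nat) :
  beta s k.+1 n.+1 =
  ((k.+1 + n.+1 - 1)%N%:R)^-1 *:
    (\sum_(i < n) qc_op i (beta s k.+1 n) +
     2^-1 *: \sum_(i < n.+1) t_op i (beta s k n.+1)).
Proof. by []. Qed.

(* The operations above, defined on representatives, do not depend on the
   names of the ends. *)
Lemma add_edge_same (V K K' L : finType) (u v : V) (G : graph V K L)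
    (H : graph V K' L) : same_upto_ends G H ->
  same_upto_ends (add_edge u v G) (add_edge u v H).
Proof.
case/same_upto_endsP => g /and5P[bI /bijbP[h gK hK] /eqP Ei /eqP Ee /forallP P].
pose g' (x : K + bool) : K' + bool :=
  match x with inl y => inl (g y) | inr b => inr b end.
have E (X : {set {set K}}) :
    [set g' @: (e : {set K + bool}) | e in [set inl @: (e : {set K}) | e in X]]
    = [set inl @: (e : {set K'}) | e in [set g @: (e : {set K}) | e in X]].
  rewrite -!imset_comp; apply: eq_imset => e /=.
  by rewrite -!imset_comp; apply: eq_imset.
apply/same_upto_endsP; exists g'; apply/and5P; split=> //.
- apply/bijbP; exists (fun x => match x with inl y => inl (h y) | inr b => inr b
    end); by case=> //= x; rewrite ?gK ?hK.
- by rewrite /Eint /= imsetU1 E imsetU1 imset_set1 Ei.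
- by rewrite /Eext /= E Ee.
apply/forallP => -[x|b]; rewrite /place /= !ffunE ?map_place_id //.
by have := P x; rewrite map_place_id.
Qed.

Lemma same_connected (V K K' L : finType) (G : graph V K L)
  (H : graph V K' L) : same_upto_ends G H -> connected G = connected H.
Proof.
case/same_upto_endsP => g gP; have /and5P[_ _ /eqP Ei _ _] := gP.
rewrite /connected /connected_by -Ei; apply: eq_forallb => u.
apply: eq_forallb => v; apply: eq_connect => {u v} u v.
by rewrite -(is_iso_adj _ _ _ gP).
Qed.

Lemma place_split (n : nat) (K L : finType) (D : {set K})
    (G : graph 'I_n K L) x :
  place (split_vertex D G) x =
  map_place (fun v => if x \in D then ord_max else old_vertex v) (place G x).
Proof. exact: ffunE. Qed.

Lemma sc_graph_same (n s : nat) (K K' : finType) (i : 'I_n)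
    (G : graph 'I_n K 'I_s) (H : graph 'I_n K' 'I_s) :
  same_upto_ends G H -> sc_graph i G = sc_graph i H.
Proof.
case/same_upto_endsP => g gP.
have /and5P[bI bb Ei Ee /forallP P] := gP.
have /bijbP bg := bb; have gI := bij_inj bg; have [h gK hK] := bg.
have ghK (A : {set K'}) : g @: (h @: A) = A.
  by rewrite -imset_comp -[RHS]imset_id; apply: eq_imset.
have hgK (A : {set K}) : h @: (g @: A) = A.
  by rewrite -imset_comp -[RHS]imset_id; apply: eq_imset.
pose gg (E : {set K} * {set K}) := (g @: E.1, g @: E.2).
have bgg : bijective gg.
  exists (fun E : {set K'} * {set K'} => (h @: E.1, h @: E.2)).
    by case=> A B; rewrite /gg /= !hgK.
  by case=> A B; rewrite /gg /= !ghK.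
have splitP (A : {set K}) :
    same_upto_ends (split_vertex A G) (split_vertex (g @: A) H).
  apply/same_upto_endsP; exists g; apply/and5P.
  split; [by apply/bijbP; exists id | exact: bb | exact: Ei | exact: Ee |].
  apply/forallP => x; rewrite !place_split (eqP (P x)) !map_place_id.
  by rewrite mem_imset.
have eqC (A : {set K}) :
    gclass (split_vertex A G) = gclass (split_vertex (g @: A) H).
  exact: (proj2 (gclass_eq _ _) (splitP A)).
have endsE : g @: ends_at G i = ends_at H i.
  apply/setP => x; rewrite -(hK x) mem_imset // !inE (eqP (P _)).
  by rewrite map_place_id.
rewrite /sc_graph [RHS](reindex gg); last exact: onW_bij.
apply: eq_big => [E|E _]; last first.
  by rewrite (eqC E.2).
rewrite (same_connected (splitP E.2)) /distribution -endsE -imsetU.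
rewrite (inj_eq (imset_inj gI)) -!setI_eq0 -imsetI ?imset_eq0 //.
by move=> ? ? _ _; apply: gI.
Qed.

(* Main.v *)
Require Import Defs.
From HB Require Import structures.
From mathcomp Require Import all_boot all_order all_algebra.
From mathcomp Require Import perm finmap zify ring.
From mathcomp.multinomials Require Import monalg.

Set Implicit Arguments.
Unset Strict Implicit.
Unset Printing Implicit Defensive.

Import Order.TTheory GRing.Theory Num.Theory.

Local Open Scope ring_scope.

(** Why the theorem holds.

   Every sum is taken over graphs with named vertices and named ends. By orbit
   counting [card_isomorphic], a graph G with n vertices and N ends is
   isomorphic to n! N! / S(G) graphs on a fixed set of vertices and a fixed set
   of ends. So a sum of the inverse symmetry factors over isomorphism classes
   is (n! N!)^-1 times a sum over all named graphs. For connected graphs, the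
   cyclomatic number k is determined by N, namely N + 2 = 2 (k + n + s)
   [cyclomatic_connected], so all biconnected graphs with given n, k and s may
   be named on the same set of N ends. The core of the proof is the identity
   [pairing_beta]: for every isomorphism-invariant function phi, the linear form
   defined by phi takes the value
     (n! N!)^-1 * (sum of phi over the named biconnected graphs)
   at beta. When phi is the indicator of an isomorphism class, this is the
   inverse of the symmetry factor.

   The identity is proved by induction along the recursion. The sum of phi over
   the graphs, multiplied by the number k + n - 1 of internal edges, is the sum
   over the graphs with one marked edge. Renaming the ends turns the marked edge
   into a prescribed one [sum_card_Eint], so that the graph is [add_edge u v H]
   for a unique (u, v, H) [sum_new_edge]. If u = v, the marked edge is a loop
   and H is an arbitrary biconnected graph: this is the term of t_i. If u and v
   differ, renaming the vertices turns v into the last vertex, and merging v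
   into u shows that H is a unique splitting of a graph with one vertex less
   [sum_merge]; the result of adding the edge is biconnected if and only if the
   splitting is connected and the merged graph is biconnected
   [biconnected_merge]: this is the term of q_i. The factors 1/2 and
   1 / (k + n - 1) and the factorials match [biconn_sum_mark_edge]. The
   induction starts from the star, which has no automorphism but the identity, and
   from the absence of biconnected trees with two or more vertices
   [biconnected_card_ends].

   For positivity, the recursion has nonnegative coefficients, and it reaches
   every biconnected graph: contract a non-loop edge at the last vertex, or, if
   there is only one vertex, erase a loop [pairing_beta_gt0]. Since the
   coefficients are nonnegative, the identity for the indicator of the
   complement of the biconnected graphs shows that beta is supported on these
   [msupp_beta]. *)

(** * Transporting graphs *)

Lemma graph_eqP (V K L : finType) (G H : graph V K L) :
  Eint G = Eint H -> Eext G = Eext H -> place G =1 place H -> G = H.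
Proof.
move=> Ei Ee Ep; apply: val_inj.
case: G H Ei Ee Ep => [[a b c] p] [[a' b' c'] p'].
by rewrite /Eint /Eext /place /= => -> -> /ffunP ->.
Qed.

Definition vmap_data (V V' K L : finType) (f : V -> V') (d : gdata V K L) :
    gdata V' K L :=
  GData (dint d) (dext d) [ffun x => map_place f (dplace d x)].

Lemma vmap_axiom (V V' K L : finType) (f : V -> V') (G : graph V K L) :
  graph_axiom (vmap_data f G).
Proof.
case/and5P: (graphP G) => V0 dE pE cE /and3P[iE eE lE].
apply/and5P; split=> //=.
  by have [v _] := card_gt0P V0; apply/card_gt0P; exists (f v).
apply/and3P; split.
- apply/forall_inP => e eG; apply/forall_inP => x xe.
  by rewrite ffunE attached_map (forall_inP (forall_inP iE _ eG)).
- apply/forall_inP => e eG; rewrite -(eqP (forall_inP eE _ eG)).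
  by apply/eqP/eq_card => x; rewrite !inE ffunE attached_map.
apply/forallP => l; rewrite -(eqP (forallP lE l)).
by apply/eqP/eq_card => x; rewrite !inE ffunE; case: (dplace G x).
Qed.

(** The map on vertices is arbitrary: a bijection renames the vertices, and a
   map that identifies two vertices is the contraction used below. *)
Definition vmap (V V' K L : finType) (f : V -> V') (G : graph V K L) :
  graph V' K L := Graph (vmap_axiom f G).

Lemma place_vmap (V V' K L : finType) (f : V -> V') (G : graph V K L) x :
  place (vmap f G) x = map_place f (place G x).
Proof. exact: ffunE. Qed.

Lemma vmapK (V V' K L : finType) (f : V -> V') (f' : V' -> V) :
  cancel f f' -> cancel (@vmap V V' K L f) (vmap f').
Proof.
move=> fK G; apply: graph_eqP => // x; rewrite !place_vmap.
by case: (place G x) => //= v; rewrite fK.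
Qed.

Lemma relabelK (V K K' L : finType) (g : K -> K') (g' : K' -> K)
    (gK : cancel g g') (g'K : cancel g' g) :
  cancel (@relabel V K K' L g g' gK g'K) (relabel g'K gK).
Proof.
have E (X : {set {set K}}) : [set g' @: (e : {set K'}) |
    e in [set g @: (e : {set K}) | e in X]] = X.
  rewrite -imset_comp -[RHS]imset_id; apply: eq_imset => e /=.
  by rewrite -imset_comp -[RHS]imset_id; apply: eq_imset.
move=> G; apply: graph_eqP; rewrite /Eint /Eext /place /= ?E //.
by move=> x; rewrite !ffunE gK.
Qed.

Lemma vmap_iso (V V' K L : finType) (f : V -> V') (G : graph V K L) :
  bijective f -> is_iso G (vmap f G) f id.
Proof.
move=> bf; have E (X : {set {set K}}) : [set id @: (e : {set K}) | e in X] = X.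
  by rewrite -[RHS]imset_id; apply: eq_imset => e; rewrite imset_id.
rewrite /is_iso !E !eqxx /=; apply/and3P; split; first exact/bijbP.
  by apply/bijbP; exists id.
by apply/forallP => x; rewrite place_vmap.
Qed.

Lemma iso_transport (V V' K K' L : finType) (G : graph V K L)
    (H : graph V' K' L) f g g' (gK : cancel g g') (g'K : cancel g' g) :
  is_iso G H f g -> H = vmap f (relabel gK g'K G).
Proof.
case/and5P=> _ _ /eqP Ei /eqP Ee /forallP P; apply: graph_eqP => //.
by move=> x; rewrite place_vmap /place /= ffunE -{1}(g'K x); apply/eqP/P.
Qed.

Lemma transport_iso (V V' K K' L : finType) (G : graph V K L) f g g'
    (gK : cancel g g') (g'K : cancel g' g) :
  bijective f -> is_iso G (vmap f (relabel gK g'K G) : graph V' K' L) f g.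
Proof.
by move=> bf; apply: is_iso_comp (relabel_iso gK g'K G) (vmap_iso _ bf).
Qed.

Lemma isomorphicP (V V' K K' L : finType) (G : graph V K L)
    (H : graph V' K' L) :
  reflect (exists f g, is_iso G H f g) (isomorphic G H).
Proof.
apply: (iffP existsP) => [[psi P]|[f [g P]]]; first by exists psi.1, psi.2.
exists (finfun f, finfun g); rewrite -(eq_is_iso G H (f := f) (g := g)) //.
  by move=> x; rewrite ffunE.
by move=> x; rewrite ffunE.
Qed.

Lemma same_isomorphic (V K K' L : finType) (G : graph V K L)
    (H : graph V K' L) : same_upto_ends G H -> isomorphic G H.
Proof. by case/same_upto_endsP => g P; apply/isomorphicP; exists id, g. Qed.

Lemma isomorphic_sym (V V' K K' L : finType) (G : graph V K L)
    (H : graph V' K' L) : isomorphic G H -> isomorphic H G.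
Proof.
case/isomorphicP => f [g P]; have /and5P[/bijbP[f' fK f'K] bg _ _ _] := P.
move/bijbP: bg => [g' gK g'K]; apply/isomorphicP; exists f', g'.
exact: is_iso_inv P.
Qed.

Lemma isomorphic_trans (V V' V'' K K' K'' L : finType) (G : graph V K L)
    (H : graph V' K' L) (I : graph V'' K'' L) :
  isomorphic G H -> isomorphic H I -> isomorphic G I.
Proof.
case/isomorphicP => f [g P] /isomorphicP[f' [g' P']].
by apply/isomorphicP; exists (f' \o f), (g' \o g); apply: is_iso_comp P P'.
Qed.

(** Stated for an arbitrary set F of edges, because biconnectedness also asks
   for connectedness after the removal of an edge. *)
Lemma iso_connected_by (V V' K K' L : finType) (G : graph V K L)
    (H : graph V' K' L) f g (F : {set {set K}}) : is_iso G H f g ->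
  connected_by H [set g @: (e : {set K}) | e in F] = connected_by G F.
Proof.
move=> P; have /and5P[/bijbP bf _ _ _ _] := P; have fI := bij_inj bf.
have [f' fK f'K] := bf.
have E u v : connect (adj H [set g @: (e : {set K}) | e in F]) (f u) (f v) =
             connect (adj G F) u v.
  apply/idP/idP => /connectP[p].
    elim: p u => [|w p IHp] u /=; first by move=> _ /fI ->.
    move=> /andP[uw pw] vE; rewrite -(f'K w) (is_iso_adj _ _ _ P) in uw.
    apply: connect_trans (connect1 uw) _; apply: IHp; rewrite f'K //.
  elim: p u => [|w p IHp] u /=; first by move=> _ ->.
  move=> /andP[uw pw] vE; rewrite -(is_iso_adj _ _ _ P) in uw.
  by apply: connect_trans (connect1 uw) _; apply: IHp.
apply/forallP/forallP => C u; apply/forallP => v.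
  by rewrite -E (forallP (C _)).
by rewrite -(f'K u) -(f'K v) E (forallP (C _)).
Qed.

Lemma iso_connected (V V' K K' L : finType) (G : graph V K L)
  (H : graph V' K' L) : isomorphic G H -> connected G = connected H.
Proof.
case/isomorphicP => f [g P]; have /and5P[_ _ /eqP Ei _ _] := P.
by rewrite /connected -Ei (iso_connected_by _ P).
Qed.

Lemma iso_biconnected (V V' K K' L : finType) (G : graph V K L)
  (H : graph V' K' L) : isomorphic G H -> biconnected G = biconnected H.
Proof.
move=> GH; rewrite /biconnected (iso_connected GH); congr (_ && _).
case/isomorphicP: GH => f [g P]; have /and5P[_ /bijbP bg /eqP Ei _ _] := P.
have gI := imset_inj (bij_inj bg).
have E (e : {set K}) :
    Eint H :\ (g @: e) = [set g @: (e' : {set K}) | e' in Eint G :\ e].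
  rewrite -Ei; apply/setP => e'.
  apply/setD1P/imsetP => [[ne /imsetP[d dG Ed]]|].
    by exists d; rewrite // !inE dG andbT; apply: contraNneq ne => <-;
       apply/eqP.
  case=> d; rewrite !inE => /andP[de dG] ->; split; last exact: imset_f.
  by rewrite (inj_eq gI).
apply/forall_inP/forall_inP => C e eG; last first.
  by rewrite -(iso_connected_by _ P) -E C // -Ei imset_f.
rewrite -Ei in eG; case/imsetP: eG => d dG ->.
by rewrite E (iso_connected_by _ P) C.
Qed.

Lemma iso_card_ends (V V' K K' L : finType) (G : graph V K L)
  (H : graph V' K' L) : isomorphic G H -> #|K| = #|K'|.
Proof.
by case/isomorphicP => f [g /and5P[_ /bijbP bg _ _ _]]; apply: bij_eq_card bg.
Qed.

Lemma eq_card_bij (A B : finType) : #|A| = #|B| ->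
  exists f : A -> B, bijective f.
Proof.
move=> AB; exists (fun x => enum_val (cast_ord AB (enum_rank x))).
exists (fun y => enum_val (cast_ord (esym AB) (enum_rank y))) => x;
by rewrite enum_valK ?cast_ordK ?cast_ordKV enum_rankK.
Qed.

Lemma sum_vmap (V V' K L : finType) (f : V -> V') (F : graph V' K L -> rat) :
  bijective f ->
  \sum_(G : graph V' K L) F G = \sum_(G : graph V K L) F (vmap f G).
Proof.
case=> f' fK f'K; apply: reindex; apply: onW_bij.
by exists (vmap f'); apply: vmapK.
Qed.

Lemma sum_relabel (V K K' L : finType) (g : K -> K') (g' : K' -> K)
    (gK : cancel g g') (g'K : cancel g' g) (F : graph V K' L -> rat) :
  \sum_(G : graph V K' L) F G = \sum_(G : graph V K L) F (relabel gK g'K G).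
Proof.
by apply: reindex; apply: onW_bij; exists (relabel g'K gK); apply: relabelK.
Qed.

(** * Counting the graphs isomorphic to a given one *)

(** The isomorphisms from G to H form a torsor under the automorphisms of G:
   composition with a fixed isomorphism is a bijection. *)
Lemma card_isos (V V' K K' L : finType) (G : graph V K L)
    (H : graph V' K' L) : isomorphic G H ->
  #|[set psi : {ffun V -> V'} * {ffun K -> K'} | is_iso G H psi.1 psi.2]| =
  symmetry_factor G.
Proof.
case/isomorphicP => f [g P]; have /and5P[/bijbP[f' fK f'K] bg _ _ _] := P.
move/bijbP: bg => [g' gK g'K].
pose h (psi : {ffun V -> V} * {ffun K -> K}) :
  {ffun V -> V'} * {ffun K -> K'} :=
  ([ffun v => f (psi.1 v)], [ffun x => g (psi.2 x)]).
pose h' (psi : {ffun V -> V'} * {ffun K -> K'}) :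
  {ffun V -> V} * {ffun K -> K} :=
  ([ffun v => f' (psi.1 v)], [ffun x => g' (psi.2 x)]).
have hK : cancel h h'.
  by case=> a b; congr (_, _); apply/ffunP => z; rewrite !ffunE /= ?fK ?gK.
have h'K : cancel h' h.
  by case=> a b; congr (_, _); apply/ffunP => z; rewrite !ffunE /= ?f'K ?g'K.
rewrite /symmetry_factor -(card_imset _ (can_inj hK)); apply: eq_card => psi.
rewrite -[psi in LHS]h'K -[psi in RHS]h'K mem_imset; last exact: can_inj hK.
rewrite !inE; have P' := is_iso_inv fK f'K gK g'K P.
have E1 : psi.1 =1 f \o (h' psi).1 by move=> v; rewrite /= ffunE f'K.
have E2 : psi.2 =1 g \o (h' psi).2 by move=> v; rewrite /= ffunE g'K.
have E1' : f' \o psi.1 =1 (h' psi).1 by move=> v; rewrite /= ffunE.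
have E2' : g' \o psi.2 =1 (h' psi).2 by move=> v; rewrite /= ffunE.
rewrite [h (h' psi)]h'K; apply/idP/idP => Q.
  by rewrite -(eq_is_iso _ _ E1' E2'); apply: is_iso_comp Q P'.
by rewrite (eq_is_iso _ _ E1 E2); apply: is_iso_comp Q P.
Qed.

(** Double counting: every pair of bijections carries G to exactly one graph,
   and a graph isomorphic to G is reached once for each automorphism of G. *)
Lemma card_isomorphic (V K K' L : finType) (G : graph V K L) : #|K| = #|K'| ->
  (#|[set H : graph V K' L | isomorphic G H]| * symmetry_factor G =
   (#|V|)`! * (#|K|)`!)%N.
Proof.
move=> KK'; pose A (H : graph V K' L) :=
  [set psi : {ffun V -> V} * {ffun K -> K'} | is_iso G H psi.1 psi.2].
rewrite -sum_nat_const.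
have -> : (\sum_(H in [set H : graph V K' L | isomorphic G H])
    symmetry_factor G = \sum_(H : graph V K' L)
      \sum_(psi : {ffun V -> V} * {ffun K -> K'}) is_iso G H psi.1 psi.2)%N.
  rewrite big_mkcond /=; apply: eq_bigr => H _; rewrite inE.
  case: ifP => [/card_isos <-|nH].
    by rewrite -sum1_card big_mkcond; apply: eq_bigr => psi _; rewrite inE.
  rewrite big1 // => psi _; apply/eqP; rewrite eqb0.
  by apply/negP => P; case/isomorphicP: nH; exists psi.1, psi.2.
rewrite exchange_big /= -!ffactnn {1}KK' -!card_inj_ffuns -cardsX -sum1_card.
rewrite [RHS]big_mkcond /=; apply: eq_bigr => -[f g] _.
rewrite !inE /=; case: (boolP (injectiveb f && injectiveb g)); last first.
  move=> nfg; apply: big1 => H _; apply/eqP; rewrite eqb0.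
  apply: contra nfg => /and5P[/bijbP/bij_inj/injectiveP->].
  by move=> /bijbP/bij_inj gI _ _ _; apply/injectiveP.
case/andP=> /injectiveP fI /injectiveP gI.
have [f' fK f'K] := injF_bij fI.
have [g' gK g'K] := inj_card_bij gI (eq_leq (esym KK')).
rewrite (bigD1 (vmap f (relabel gK g'K G))) //=.
rewrite (transport_iso _ _ _ (injF_bij fI)).
rewrite big1 // => H; apply: contraNeq; rewrite eqb0 negbK.
by move/(iso_transport gK g'K)/eqP.
Qed.

(** * Adding an edge and contracting it *)

Definition new_edge (K : finType) : {set K + bool} := [set inr true; inr false].

Definition old_edges (K : finType) (F : {set {set K}}) : {set {set K + bool}} :=
  [set inl @: (e : {set K}) | e in F].

Lemma inl_inj (A B : Type) : injective (@inl A B).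
Proof. by move=> x y []. Qed.

Lemma imset_inl_inj (K : finType) :
  injective (fun e : {set K} => (@inl K bool) @: e).
Proof. exact/imset_inj/inl_inj. Qed.

Lemma inr_imset_inl (K : finType) (e : {set K}) (b : bool) :
  (inr b \in (@inl K bool) @: e) = false.
Proof. by apply/imsetP => -[]. Qed.

Lemma new_edge_old (K : finType) (F : {set {set K}}) :
  (new_edge K \in old_edges F) = false.
Proof.
apply/imsetP => -[e _ E]; have := inr_imset_inl e true.
by rewrite -E !inE eqxx.
Qed.

Lemma mem_old_edges (K : finType) (F : {set {set K}}) (e : {set K}) :
  ((@inl K bool) @: e \in old_edges F) = (e \in F).
Proof. by rewrite mem_imset //; apply: imset_inl_inj. Qed.

Lemma Eint_add_edge (V K L : finType) (u v : V) (G : graph V K L) :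
  Eint (add_edge u v G) = new_edge K |: old_edges (Eint G).
Proof. by []. Qed.

Lemma place_add_edge_old (V K L : finType) (u v : V) (G : graph V K L) x :
  place (add_edge u v G) (inl x) = place G x.
Proof. by rewrite /place /= ffunE. Qed.

Lemma place_add_edge_new (V K L : finType) (u v : V) (G : graph V K L) b :
  place (add_edge u v G) (inr b) = inl (if b then u else v).
Proof. by rewrite /place /= ffunE. Qed.

Lemma adjU (V K L : finType) (G : graph V K L) (A B : {set {set K}}) u v :
  adj G (A :|: B) u v = adj G A u v || adj G B u v.
Proof.
apply/exists_inP/orP => [[e]|].
  by rewrite inE => /orP[] eA P; [left|right]; apply/exists_inP; exists e.
by case=> /exists_inP[e eA P]; exists e; rewrite // inE eA ?orbT.
Qed.

Lemma adj_sym (V K L : finType) (G : graph V K L) (F : {set {set K}}) :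
  symmetric (adj G F).
Proof.
suff H u v : adj G F u v -> adj G F v u by move=> u v; apply/idP/idP; apply: H.
case/exists_inP=> e eF /exists_inP[x xe /exists_inP[y ye /and3P[xy xu yv]]].
apply/exists_inP; exists e => //; apply/exists_inP; exists y => //.
by apply/exists_inP; exists x => //; rewrite eq_sym xy yv xu.
Qed.

Lemma adj_old_edges (V K L : finType) (u v : V) (G : graph V K L)
    (F : {set {set K}}) x y :
  adj (add_edge u v G) (old_edges F) x y = adj G F x y.
Proof.
apply/exists_inP/exists_inP => -[e eF /exists_inP[a ae /exists_inP[b be ab]]].
  case/imsetP: eF => e' eF E; rewrite E in ae be.
  case/imsetP: ae be ab => a' ae -> /imsetP[b' be ->].
  rewrite !place_add_edge_old (inj_eq (@inl_inj _ _)) => ab; exists e' => //.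
  by apply/exists_inP; exists a' => //; apply/exists_inP; exists b'.
exists (inl @: e); first exact: imset_f.
apply/exists_inP; exists (inl a); first exact: imset_f.
by apply/exists_inP; exists (inl b); rewrite ?imset_f // !place_add_edge_old.
Qed.

Lemma adj_new_edge (V K L : finType) (u v : V) (G : graph V K L) x y :
  adj (add_edge u v G) [set new_edge K] x y =
  (u == x) && (v == y) || (u == y) && (v == x).
Proof.
have P := place_add_edge_new.
apply/exists_inP/orP => [[e /set1P-> /exists_inP[a ae /exists_inP[b be ab]]]|].
  by case/set2P: ae ab => ->; case/set2P: be => ->; rewrite !P //= => E;
     [left|right; rewrite andbC].
move=> uv; exists (new_edge K); first exact: set11.
case: uv => /andP[/eqP-> /eqP->]; apply/exists_inP.
  exists (inr true); first exact: set21; apply/exists_inP.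
  by exists (inr false); [exact: set22|rewrite !P !eqxx].
exists (inr false); first exact: set22; apply/exists_inP.
by exists (inr true); [exact: set21|rewrite !P !eqxx].
Qed.

Lemma adj_add_edge (V K L : finType) (u v : V) (G : graph V K L)
    (F : {set {set K}}) x y :
  adj (add_edge u v G) (new_edge K |: old_edges F) x y =
  [|| adj G F x y, (u == x) && (v == y) | (u == y) && (v == x)].
Proof. by rewrite adjU adj_new_edge adj_old_edges orbC. Qed.

Lemma connected_by_old_edges (V K L : finType) (u v : V) (G : graph V K L)
    (F : {set {set K}}) :
  connected_by (add_edge u v G) (old_edges F) = connected_by G F.
Proof.
apply: eq_forallb => x; apply: eq_forallb => y; apply: eq_connect => a b.
exact: adj_old_edges.
Qed.

(** A step along the loop stays at its vertex. *)
Lemma connected_by_add_loop (V K L : finType) (u : V) (G : graph V K L)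
    (F : {set {set K}}) :
  connected_by (add_edge u u G) (new_edge K |: old_edges F) = connected_by G F.
Proof.
apply: eq_forallb => x; apply: eq_forallb => y; apply/idP/idP; last first.
  apply: connect_sub => a b ab; apply: connect1.
  by rewrite adj_add_edge ab.
apply: connect_sub => a b; rewrite adj_add_edge => /orP[ab|].
  exact: connect1.
by case/orP=> /andP[/eqP<- /eqP<-].
Qed.

Lemma connected_byS (V K L : finType) (G : graph V K L) (A B : {set {set K}}) :
  A \subset B -> connected_by G A -> connected_by G B.
Proof.
move=> /setUidPr AB /forallP C; apply/forallP => u; apply/forallP => v.
apply: connect_sub (forallP (C u) v) => a b ab; apply: connect1.
by rewrite -AB adjU ab.
Qed.

Definition merge_vertex (n : nat) (i : 'I_n) (v : 'I_n.+1) : 'I_n :=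
  if unlift ord_max v is Some j then j else i.

Definition merge (n : nat) (K L : finType) (i : 'I_n) (G : graph 'I_n.+1 K L) :
  graph 'I_n K L := vmap (merge_vertex i) G.

Lemma old_vertexE (n : nat) (j : 'I_n) : old_vertex j = lift ord_max j.
Proof. by apply: val_inj; rewrite /= /bump leqNgt ltn_ord. Qed.

Lemma merge_vertex_max (n : nat) (i : 'I_n) : merge_vertex i ord_max = i.
Proof. by rewrite /merge_vertex unlift_none. Qed.

Lemma merge_vertex_old (n : nat) (i j : 'I_n) :
  merge_vertex i (old_vertex j) = j.
Proof. by rewrite /merge_vertex old_vertexE liftK. Qed.

Lemma vertexP (n : nat) (v : 'I_n.+1) :
  v = ord_max \/ exists j, v = old_vertex j.
Proof.
case: (unliftP ord_max v) => [j|] ->; last by left.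
by right; exists j; rewrite old_vertexE.
Qed.

(** A walk in either graph projects or lifts to a walk in the other, since
   [ord_max] and the vertex i, which [merge] identifies, are joined by the new
   edge. *)
Lemma connected_by_merge (n : nat) (K L : finType) (i : 'I_n)
    (G : graph 'I_n.+1 K L) (F : {set {set K}}) :
  connected_by (add_edge (old_vertex i) ord_max G)
    (new_edge K |: old_edges F) = connected_by (merge i G) F.
Proof.
pose E := adj (add_edge (old_vertex i) ord_max G) (new_edge K |: old_edges F).
rewrite /connected_by -/E; pose h := merge_vertex i.
have csym := sym_connect_sym (adj_sym (add_edge (old_vertex i) ord_max G)
  (new_edge K |: old_edges F)).
have hE a b : E a b -> connect (adj (merge i G) F) (h a) (h b).
  rewrite /E adj_add_edge => /orP[ab|]; last first.
    by case/orP => /andP[/eqP<- /eqP<-];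
       rewrite /h merge_vertex_max merge_vertex_old.
  apply: connect1; case/exists_inP: ab => e eF /exists_inP[x xe].
  case/exists_inP=> y ye /and3P[xy /eqP xa /eqP yb].
  apply/exists_inP; exists e => //; apply/exists_inP; exists x => //.
  by apply/exists_inP; exists y => //; rewrite xy !place_vmap xa yb /= !eqxx.
have Eh a : connect E (old_vertex (h a)) a.
  case: (vertexP a) => [->|[j ->]]; rewrite /h ?merge_vertex_old //.
  rewrite merge_vertex_max; apply: connect1.
  by rewrite /E adj_add_edge !eqxx orbT.
have hE' a b : adj (merge i G) F a b -> connect E (old_vertex a) (old_vertex b).
  case/exists_inP=> e eF /exists_inP[x xe /exists_inP[y ye /and3P[xy]]].
  rewrite !place_vmap; case xa: (place G x) => [a'|//] /= /eqP[<-].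
  case yb: (place G y) => [b'|//] /= /eqP[<-].
  apply: connect_trans (Eh a') _; rewrite csym; apply: connect_trans (Eh b') _.
  apply: connect1; rewrite /E adj_sym adj_add_edge; apply/orP; left.
  apply/exists_inP; exists e => //; apply/exists_inP; exists x => //.
  by apply/exists_inP; exists y => //; rewrite xy xa yb !eqxx.
(* walks are mapped to walks as soon as steps are *)
have homo (T T' : finType) (e : rel T) (e' : rel T') (f : T -> T') :
    (forall a b, e a b -> connect e' (f a) (f b)) ->
    forall a b, connect e a b -> connect e' (f a) (f b).
  move=> H a b /connectP[p]; elim: p a => [|c p IHp] a /=; first by move=> _ ->.
  by case/andP=> /H ac pP bE; apply: connect_trans ac (IHp _ pP bE).
apply/forallP/forallP => C a; apply/forallP => b.
  rewrite -(merge_vertex_old i a) -(merge_vertex_old i b).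
  exact: homo hE _ _ (forallP (C _) _).
apply: connect_trans (connect_trans _ (Eh b)).
  by rewrite csym; apply: Eh.
exact: homo hE' _ _ (forallP (C _) _).
Qed.

(** Connectedness of G, which is what remains when the new edge is erased,
   already implies connectedness of the graph with the new edge. *)
Lemma biconnected_add_edge (V K L : finType) (u v : V) (G : graph V K L) :
  biconnected (add_edge u v G) =
  connected G && [forall e in Eint G,
    connected_by (add_edge u v G) (new_edge K |: old_edges (Eint G :\ e))].
Proof.
rewrite /biconnected /connected Eint_add_edge.
have D1 : (new_edge K |: old_edges (Eint G)) :\ new_edge K = old_edges (Eint G).
  by rewrite setU1K // new_edge_old.
have D2 e : (new_edge K |: old_edges (Eint G)) :\ (inl @: (e : {set K})) =
    new_edge K |: old_edges (Eint G :\ e).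
  apply/setP => f; rewrite !inE.
  have [->|nf] /= := eqVneq f (new_edge K).
    rewrite andbT; apply/eqP => E; have := inr_imset_inl e true.
    by rewrite -E !inE eqxx.
  apply/andP/imsetP => [[fe /imsetP[d dG Ed]]|[d]].
    exists d => //; rewrite !inE dG andbT; apply: contraNneq fe => <-.
    by rewrite Ed.
  rewrite !inE => /andP[de dG] ->; rewrite (inj_eq (@imset_inl_inj K)) de.
  by rewrite mem_old_edges.
apply/andP/andP => -[C /forall_inP B]; split.
- by rewrite -(connected_by_old_edges u v) -D1; apply: B; rewrite setU11.
- by apply/forall_inP => e eG; rewrite -D2 B // !inE mem_old_edges eG orbT.
- apply: connected_byS (subsetU1 _ _) _.
  by rewrite connected_by_old_edges.
apply/forall_inP => f; rewrite in_setU1 => /orP[/eqP->|/imsetP[e eG ->]].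
  by rewrite D1 connected_by_old_edges.
by rewrite D2 B.
Qed.

Lemma biconnected_add_loop (V K L : finType) (u : V) (G : graph V K L) :
  biconnected (add_edge u u G) = biconnected G.
Proof.
rewrite biconnected_add_edge; congr (_ && _); apply: eq_forallb => e.
by rewrite connected_by_add_loop.
Qed.

(** Erasing the new edge leaves G, and erasing any other edge may be tested
   after the new edge has been contracted. *)
Lemma biconnected_merge (n : nat) (K L : finType) (i : 'I_n)
    (G : graph 'I_n.+1 K L) :
  biconnected (add_edge (old_vertex i) ord_max G) =
  connected G && biconnected (merge i G).
Proof.
rewrite biconnected_add_edge /biconnected andbA; congr (_ && _).
  rewrite andb_idr // => C; rewrite /connected -connected_by_merge.
  by apply: connected_byS (subsetU1 _ _) _; rewrite connected_by_old_edges.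
by apply: eq_forallb => e; rewrite connected_by_merge.
Qed.

Lemma connected_merge (n : nat) (K L : finType) (i : 'I_n)
    (G : graph 'I_n.+1 K L) :
  connected (add_edge (old_vertex i) ord_max G) = connected (merge i G).
Proof. by rewrite /connected Eint_add_edge connected_by_merge. Qed.

(** * Graphs with a given edge *)

Lemma int_attached (V K L : finType) (G : graph V K L) e x :
  e \in Eint G -> x \in e -> attached (place G x).
Proof.
case/and5P: (graphP G) => _ _ _ _ /and3P[/forall_inP iE _ _].
by move=> /iE/forall_inP; apply.
Qed.

(** The inverse of [add_edge]; the data satisfy the axioms of a graph only if
   [new_edge] is an internal edge. *)
Definition del_edge_data (V K L : finType) (d : gdata V (K + bool)%type L) :
    gdata V K L :=
  GData [set e : {set K} | inl @: e \in dint d]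
        [set e : {set K} | inl @: e \in dext d] [ffun x => dplace d (inl x)].

(** The edges are disjoint, so every edge except [new_edge] consists of old
   ends. *)
Lemma del_edge_old (V K L : finType) (G : graph V (K + bool)%type L) :
  new_edge K \in Eint G ->
  old_edges (dint (del_edge_data G) :|: dext (del_edge_data G)) =
  (dint G :|: dext G) :\ new_edge K.
Proof.
case/and5P: (graphP G) => _ _ /and3P[_ /trivIsetP tE _] _ _ eG.
apply/setP => f; rewrite !inE; apply/imsetP/andP => [[e]|[fe fG]].
  by rewrite !inE => eE ->; split=> //; apply/eqP => E;
     have := inr_imset_inl e true; rewrite E !inE eqxx.
have := tE f (new_edge K); rewrite !inE (eG : _ \in dint G) fG.
move=> /(_ isT isT fe) dis.
have Ef : f = inl @: (@inl K bool @^-1: f).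
  apply/setP => -[x|b]; first by rewrite mem_imset ?inE //; apply: inl_inj.
  rewrite inr_imset_inl; apply/negP => fb.
  by have /pred0P/(_ (inr b)) := dis; rewrite /= fb !inE; case: (b).
by exists (@inl K bool @^-1: f); rewrite -?Ef // !inE -Ef.
Qed.

Lemma del_edge_axiom (V K L : finType) (G : graph V (K + bool)%type L) :
  new_edge K \in Eint G -> graph_axiom (del_edge_data G).
Proof.
move=> eG; have E := del_edge_old eG.
case/and5P: (graphP G) => V0 dE pE cE /and3P[iE eE lE].
have lI := @inl_inj K bool.
apply/and5P; split=> //; last (apply/and3P; split).
- rewrite -setI_eq0; apply/eqP/setP => e; rewrite !inE.
  apply/negP => /andP[ei ee].
  by have /pred0P/(_ (inl @: e)) := dE; rewrite /= ei ee.
- rewrite -(imset_partition _ _ lI) -/(old_edges _) E.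
  have -> : (@inl K bool) @: [set: K] = [set: K + bool] :\: new_edge K.
    apply/setP => -[x|b]; first by rewrite mem_imset // !inE.
    by rewrite inr_imset_inl !inE; case: b.
  by apply: partitionD1 => //; rewrite inE eG.
- apply/forall_inP => e; rewrite !inE -in_setU => /(forall_inP cE).
  by rewrite card_imset.
- apply/forall_inP => e; rewrite inE => /(forall_inP iE)/forall_inP H.
  by apply/forall_inP => x xe; rewrite ffunE H // imset_f.
- apply/forall_inP => e; rewrite inE => /(forall_inP eE)/eqP <-.
  rewrite -(card_imset _ lI); apply/eqP/eq_card => -[x|b].
    by rewrite mem_imset // !inE mem_imset // ffunE.
  by rewrite inr_imset_inl inE inr_imset_inl.
apply/forallP => l; rewrite -(eqP (forallP lE l)) -(card_imset _ lI).
apply/eqP/eq_card => -[x|b]; first by rewrite mem_imset // !inE ffunE.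
rewrite inr_imset_inl inE; apply/esym/eqP => Eb.
have := int_attached eG (x := inr b); rewrite /place Eb !inE.
by case: (b) => /(_ isT).
Qed.

Lemma add_edge_surj (V K L : finType) (G : graph V (K + bool)%type L) u v :
  new_edge K \in Eint G -> place G (inr true) = inl u ->
  place G (inr false) = inl v -> exists G' : graph V K L, G = add_edge u v G'.
Proof.
move=> eG Gu Gv; exists (Graph (del_edge_axiom eG)).
case/and5P: (graphP G) => _ dE _ _ _.
have E f : f \in dint G :|: dext G -> f != new_edge K ->
    exists2 e : {set K}, f = inl @: e & True.
  move=> fG fe; have : f \in (dint G :|: dext G) :\ new_edge K.
    by rewrite !inE fe -in_setU.
  by rewrite -(del_edge_old eG) => /imsetP[e _ ->]; exists e.
have nE : new_edge K \notin dext G.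
  apply/negP => ee; have /pred0P/(_ (new_edge K)) := dE.
  by rewrite /= ee andbT => /negP.
apply: graph_eqP.
- apply/setP => f; rewrite Eint_add_edge in_setU1.
  have [->|fe] //= := eqVneq f (new_edge K).
  apply/idP/imsetP => [fG|[e]]; last by rewrite inE => eE ->.
  have [|e Ef _] := E f _ fe; first by rewrite inE (fG : f \in dint G).
  by exists e; rewrite // inE -Ef.
- apply/setP => f; apply/idP/imsetP => [fG|[e]]; last by rewrite inE => eE ->.
  have [||e Ef _] := E f; first by rewrite inE (fG : f \in dext G) orbT.
    by apply: contraNneq nE => <-.
  by exists e; rewrite // inE -Ef.
case=> [x|b]; last by rewrite place_add_edge_new; case: b.
by rewrite place_add_edge_old /place /= ffunE.
Qed.

Lemma add_edge_inj (V K L : finType) (u v u' v' : V) (G G' : graph V K L) :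
  add_edge u v G = add_edge u' v' G' -> [/\ u = u', v = v' & G = G'].
Proof.
move=> E; have EP x : place (add_edge u v G) x = place (add_edge u' v' G') x.
  by rewrite E.
split.
- by have := EP (inr true); rewrite !place_add_edge_new => -[].
- by have := EP (inr false); rewrite !place_add_edge_new => -[].
apply: graph_eqP => [||x]; last first.
- by have := EP (inl x); rewrite !place_add_edge_old.
- by have := congr1 (@Eext _ _ _) E; apply/imset_inj/imset_inl_inj.
have := congr1 (fun H => Eint H :\ new_edge K) E.
rewrite !Eint_add_edge !setU1K ?new_edge_old //.
exact/imset_inj/imset_inl_inj.
Qed.

(** [add_edge] is a bijection from the triples (u, v, G) onto the graphs in
   which [new_edge] is an internal edge. *)
Lemma sum_new_edge (V K L : finType) (F : graph V (K + bool)%type L -> rat) :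
  \sum_(G | new_edge K \in Eint G) F G =
  \sum_(u : V) \sum_(v : V) \sum_(G : graph V K L) F (add_edge u v G).
Proof.
pose h (p : V * (V * graph V K L)) := add_edge p.1 p.2.1 p.2.2.
transitivity (\sum_(G in h @: setT) F G).
  apply: eq_bigl => G; apply/idP/imsetP => [eG|[p _ ->]]; last first.
    by rewrite /h Eint_add_edge setU11.
  have /(int_attached eG) : inr true \in new_edge K by exact: set21.
  have /(int_attached eG) : inr false \in new_edge K by exact: set22.
  case Gv: (place G (inr false)) => [v|//] _.
  case Gu: (place G (inr true)) => [u|//] _.
  by have [G' ->] := add_edge_surj eG Gu Gv; exists (u, (v, G')).
rewrite big_imset /=; last first.
  by move=> [u [v G]] [u' [v' G']] _ _ /add_edge_inj[/= -> -> ->].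
rewrite [RHS](eq_bigr _ (fun u _ =>
  pair_bigA _ (fun v (G : graph V K L) => F (add_edge u v G)))).
rewrite (pair_bigA _ (fun u (p : V * graph V K L) => F (add_edge u p.1 p.2))).
by apply: eq_bigl => p; rewrite inE.
Qed.

Lemma merge_split (n : nat) (K L : finType) (i : 'I_n) (D : {set K})
    (G : graph 'I_n K L) :
  D \subset ends_at G i -> merge i (split_vertex D G) = G.
Proof.
move=> /subsetP sD; apply: graph_eqP => // x.
rewrite place_vmap place_split; case xD: (x \in D).
  have := sD x xD; rewrite inE => /eqP -> /=.
  by rewrite merge_vertex_max.
by case: (place G x) => //= v; rewrite merge_vertex_old.
Qed.

Lemma split_merge (n : nat) (K L : finType) (i : 'I_n)
    (G : graph 'I_n.+1 K L) :
  split_vertex (ends_at G ord_max) (merge i G) = G.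
Proof.
apply: graph_eqP => // x.
rewrite place_split place_vmap inE; case: (place G x) => //= v.
case: (vertexP v) => [->|[j ->]]; first by rewrite eqxx.
by rewrite merge_vertex_old; case: eqP.
Qed.

Lemma ends_at_merge (n : nat) (K L : finType) (i : 'I_n)
    (G : graph 'I_n.+1 K L) : ends_at G ord_max \subset ends_at (merge i G) i.
Proof.
apply/subsetP => x; rewrite !inE place_vmap => /eqP -> /=.
by rewrite merge_vertex_max.
Qed.

(** A graph is determined by its image under [merge] and by the set of ends at
   [ord_max], which is an arbitrary subset of the ends at the merged vertex. *)
Lemma sum_merge (n : nat) (K L : finType) (i : 'I_n)
    (F : graph 'I_n.+1 K L -> rat) :
  \sum_G F G = \sum_(G : graph 'I_n K L)
    \sum_(D : {set K} | D \subset ends_at G i) F (split_vertex D G).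
Proof.
rewrite (partition_big (merge i) xpredT) //=; apply: eq_bigr => G _.
have Ee (D : {set K}) : D \subset ends_at G i ->
    ends_at (split_vertex D G) ord_max = D.
  move=> /subsetP sD; apply/setP => x; rewrite inE place_split.
  have [xD|nD] := boolP (x \in D).
    by have := sD x xD; rewrite inE => /eqP -> /=; rewrite eqxx.
  case: (place G x) => // v; apply/eqP => -[E].
  by have := ltn_ord v; rewrite E ltnn.
rewrite (reindex_onto (fun D => split_vertex D G)
  (fun H => ends_at H ord_max)) /=.
  apply: eq_bigl => D; apply/andP/idP => [[/eqP EG /eqP ED]|sD].
    by rewrite -ED -[X in _ \subset ends_at X _]EG ends_at_merge.
  by rewrite merge_split // Ee.
by move=> H /eqP <-; apply: split_merge.
Qed.

(** Bijections act transitively on pairs of distinct elements, so that an edge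
   may be assumed to have prescribed ends. *)
Lemma perm_pair (T : finType) (a b c d : T) : a != b -> c != d ->
  exists2 p : T -> T, bijective p & p a = c /\ p b = d.
Proof.
move=> ab cd; pose t := tperm a c; pose t' := tperm (t b) d.
have tc : t a = c by rewrite /t tpermL.
exists (t' \o t); first by apply: bij_comp; apply/injF_bij/perm_inj.
rewrite /= tc /t' tpermL; split=> //; rewrite tpermD // 1?eq_sym //.
by rewrite -tc (inj_eq perm_inj).
Qed.

(** The left-hand side is a sum over the graphs with a marked edge; a renaming
   of the ends carries the marked edge to e0, and there are 'C(#|K|, 2)
   positions for it. *)
Lemma sum_card_Eint (V K L : finType) (F : graph V K L -> rat) (e0 : {set K}) :
  #|e0| = 2%N ->
  (forall (g g' : K -> K) (gK : cancel g g') (g'K : cancel g' g) G,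
     F (relabel gK g'K G) = F G) ->
  \sum_G #|Eint G|%:R * F G = 'C(#|K|, 2)%:R * \sum_(G | e0 \in Eint G) F G.
Proof.
move=> /eqP/cards2P[c [d [cd ->]]] Finv.
transitivity (\sum_G \sum_(e : {set K} | (#|e| == 2%N) && (e \in Eint G)) F G).
  apply: eq_bigr => G _; rewrite mulr_natl -sumr_const.
  apply: eq_bigl => e; rewrite andb_idl // => eG.
  case/and5P: (graphP G) => _ _ _ /forall_inP cE _.
  by apply: cE; rewrite inE (eG : e \in dint G).
rewrite (exchange_big_dep (fun e : {set K} => #|e| == 2%N)) /=; last first.
  by move=> G e _ /andP[].
rewrite -card_draws -sum1_card natr_sum mulr_suml.
rewrite [RHS](eq_bigl (fun e : {set K} => #|e| == 2%N)); last first.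
  by move=> e; rewrite inE.
apply: eq_bigr => e e2; have /cards2P[a [b [ab Ee]]] := e2.
rewrite mul1r e2 /=.
have [g bg [ga gb]] := perm_pair cd ab; have [g' gK g'K] := bg.
rewrite big_mkcond (sum_relabel gK g'K) [RHS]big_mkcond.
apply: eq_bigr => G _; rewrite Finv /=; congr (if _ then _ else _).
have -> : e = g @: [set c; d] by rewrite imsetU1 imset_set1 ga gb.
by rewrite mem_imset //; apply/imset_inj/bij_inj.
Qed.

(** * Counting edges *)

(** The edge of the end labeled l cannot be internal, hence has exactly one
   attached end. *)
Lemma external_edge (V K L : finType) (G : graph V K L) (l : L) :
  exists a x, [/\ [set a; x] \in Eext G, attached (place G a)
                & place G x = inr l].
Proof.
case/and5P: (graphP G) => _ _ /and3P[/eqP cE tE _] /forall_inP c2.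
move=> /and3P[_ eE lE].
have [x Px] : exists x, place G x = inr l.
  have /cards1P[x /setP/(_ x)] := forallP lE l.
  by rewrite !inE eqxx => /eqP Px; exists x.
set E := dint G :|: dext G in cE tE c2.
have xe : x \in pblock E x by rewrite mem_pblock cE inE.
have eE' : pblock E x \in E by apply: pblock_mem; rewrite cE inE.
have eG : pblock E x \in Eext G.
  by move: eE'; rewrite in_setU => /orP[/int_attached/(_ xe)|//]; rewrite Px.
have /cards1P[a /setP/(_ a)] := forall_inP eE _ eG.
rewrite !inE eqxx => /andP[ae Pa]; exists a, x; split=> //.
have ax : a != x by apply: contraTneq Pa => ->; rewrite -/(place G x) Px.
suff -> : [set a; x] = pblock E x by [].
by apply/eqP; rewrite eqEcard subUset !sub1set ae xe cards2 ax (eqP (c2 _ eE')).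
Qed.

Lemma card_Eext_eq (V K L : finType) (G : graph V K L) : #|Eext G| = #|L|.
Proof.
apply/eqP; rewrite eqn_leq card_Eext /=.
have /fin_all_exists[a /fin_all_exists[x P]] := external_edge G.
rewrite -(card_image (f := fun l => [set a l; x l])).
  by apply: subset_leq_card; apply/subsetP => _ /imageP[l _ ->]; case: (P l).
move=> l m /= /setP/(_ (x l)); have [_ _ xl] := P l; have [_ am xm] := P m.
rewrite !inE eqxx orbT => /esym/orP[/eqP E|/eqP E].
  by rewrite -E xl in am.
by have [] : @inr V L l = inr m by rewrite -xl E xm.
Qed.

Lemma ncomp_connected (V K L : finType) (G : graph V K L) :
  connected G -> ncomp G = 1%N.
Proof.
move=> C; have /and5P[/card_gt0P[v _] _ _ _ _] := graphP G.
have := n_comp_connect (sym_connect_sym (adj_sym G (Eint G))) v.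
rewrite /ncomp => <-; apply: eq_n_comp_r => u.
by rewrite !inE (forallP (forallP C v)).
Qed.

(** For connected graphs the cyclomatic number only depends on the number of
   ends; adding 2 avoids a truncated subtraction. *)
Lemma cyclomatic_connected (n s k : nat) (K : finType)
    (G : graph 'I_n K 'I_s) : connected G ->
  (cyclomatic G == k%:Z) = (#|K| + 2 == 2 * (k + n + s))%N.
Proof.
move=> C; rewrite /cyclomatic ncomp_connected // card_ord (card_ends G).
by rewrite card_Eext_eq card_ord; lia.
Qed.

(** The renaming of the ends that brings an arbitrary internal edge into the
   form of [add_edge]. *)
Lemma expose_edge (V K L : finType) (G : graph V K L) a b u v :
  a != b -> [set a; b] \in Eint G ->
  place G a = inl u -> place G b = inl v ->
  exists (N : nat) (H : graph V 'I_N L), same_upto_ends G (add_edge u v H).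
Proof.
move=> ab eG Ga Gb.
have K2 : (1 < #|K|)%N.
  by rewrite -cardsT; apply: leq_trans (subset_leq_card (subsetT [set a; b]));
     rewrite cards2 ab.
have EK : #|K| = #|{: 'I_(#|K| - 2) + bool}|.
  by rewrite card_sum card_ord card_bool subnK.
have [g bg] := eq_card_bij EK.
have [|p bp [pa pb]] := @perm_pair _ (g a) (g b) (inr true) (inr false) _ isT.
  by rewrite (inj_eq (bij_inj bg)).
have [q pK qK] : bijective (p \o g) by apply: bij_comp.
pose G' := relabel pK qK G.
have Pq x : place G' ((p \o g) x) = place G x.
  by rewrite /place /= ffunE pK.
have eG' : new_edge _ \in Eint G'.
  have <- : (p \o g) @: [set a; b] = new_edge _.
    by rewrite imsetU1 imset_set1 /= pa pb.
  exact: imset_f.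
have Gu : place G' (inr true) = inl u by rewrite -pa -Ga -Pq.
have Gv : place G' (inr false) = inl v by rewrite -pb -Gb -Pq.
have [H EH] := add_edge_surj eG' Gu Gv.
exists (#|K| - 2)%N, H; apply/same_upto_endsP; exists (p \o g); rewrite -EH.
exact: relabel_iso.
Qed.

Lemma adj_edge (V K L : finType) (G : graph V K L) u v :
  adj G (Eint G) u v -> exists a b,
    [/\ a != b, [set a; b] \in Eint G, place G a = inl u & place G b = inl v].
Proof.
case/exists_inP=> e eG /exists_inP[a ae /exists_inP[b be]].
case/and3P=> [ab /eqP au /eqP bv].
exists a, b; split=> //; suff -> : [set a; b] = e by [].
case/and5P: (graphP G) => _ _ _ /forall_inP c2 _.
apply/eqP; rewrite eqEcard cards2 ab subUset !sub1set ae be /=.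
by rewrite (eqP (c2 e _)) // in_setU (eG : e \in dint G).
Qed.

Lemma connect_step (T : finType) (e : rel T) (x y : T) :
  connect e x y -> x != y -> exists2 z, z != x & e x z.
Proof.
case/connectP=> p; elim: p => [|z p IHp] /=; first by move=> _ ->; rewrite eqxx.
case/andP=> xz pz yE xy; have [zx|zx] := eqVneq z x; last by exists z.
by rewrite zx in pz yE; apply: IHp.
Qed.

(** In a connected graph with a vertex besides [ord_max], some edge that is not
   a loop ends at [ord_max]; up to the names of the ends it is the new edge. *)
Lemma expose_max_edge (n : nat) (K L : finType) (G : graph 'I_n.+2 K L) :
  connected G -> exists (i : 'I_n.+1) (N : nat) (H : graph 'I_n.+2 'I_N L),
    same_upto_ends G (add_edge (old_vertex i) ord_max H).
Proof.
move=> C; have m0 : ord_max != ord0 :> 'I_n.+2 by [].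
have [v vm] := connect_step (forallP (forallP C ord_max) ord0) m0.
case: (vertexP v) vm => [->|[i ->] _]; first by rewrite eqxx.
rewrite adj_sym => /adj_edge[a [b [ab eG Ga Gb]]].
by have [N [H GH]] := expose_edge ab eG Ga Gb; exists i, N, H.
Qed.

Lemma same_card_ends (V K K' L : finType) (u v : V) (G : graph V K L)
    (H : graph V K' L) :
  same_upto_ends G (add_edge u v H) -> #|K| = (#|K'| + 2)%N.
Proof.
by move=> /same_isomorphic/iso_card_ends ->; rewrite card_sum card_bool.
Qed.

(** Contracting one edge after the other, a connected graph with n vertices is
   seen to have at least n - 1 internal edges. *)
Lemma connected_card_ends (n s : nat) (K : finType) (G : graph 'I_n K 'I_s) :
  connected G -> (2 * (n + s) <= #|K| + 2)%N.
Proof.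
elim: n K G => [|[|n] IHn] K G C.
- by have /and5P[] := graphP G; rewrite card_ord.
- by rewrite (card_ends G) card_Eext_eq card_ord; lia.
have [i [N [H GH]]] := expose_max_edge C.
have := iso_connected (same_isomorphic GH); rewrite C connected_merge.
move=> /esym CH.
by have := IHn _ _ CH; have := same_card_ends GH; lia.
Qed.

(** Such a graph has an edge that is not a loop, and erasing it leaves a
   connected graph; so there are at least as many internal edges as vertices, and
   the cyclomatic number is positive. *)
Lemma biconnected_card_ends (n s : nat) (K : finType)
    (G : graph 'I_n.+2 K 'I_s) :
  biconnected G -> (2 * (n.+2 + s) <= #|K|)%N.
Proof.
move=> B; have /andP[C _] := B; have [i [N [H GH]]] := expose_max_edge C.
have := iso_biconnected (same_isomorphic GH).
rewrite B biconnected_add_edge => /esym/andP[CH _].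
by have := connected_card_ends CH; have := same_card_ends GH; lia.
Qed.

(** * Graphs with a single vertex and no internal edge *)

(** All ends are used up by the s external edges, and each of them is determined
   by its label. *)
Lemma isomorphic_star (s : nat) (K : finType) (G : graph 'I_1 K 'I_s) :
  #|K| = (2 * s)%N -> isomorphic (star 'I_s) G.
Proof.
move=> Ks; have Ei : Eint G = set0.
  by apply: cards0_eq; have := card_ends G; rewrite card_Eext_eq card_ord; lia.
have /fin_all_exists[a /fin_all_exists[x P]] := external_edge G.
have pE l m : a l = a m -> l = m.
  move=> lm; have [el _ xl] := P l; have [em _ xm] := P m.
  case/and5P: (graphP G) => _ _ /and3P[_ tE _] _ _.
  have E (e : {set K}) : e \in Eext G -> a l \in e ->
      pblock (dint G :|: dext G) (a l) = e.
    move=> eG ae; apply: def_pblock => //.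
    by rewrite in_setU (eG : e \in dext G) orbT.
  have := E _ el (set21 _ _); rewrite (E _ em); last by rewrite lm set21.
  move/setP/(_ (x m)); rewrite set22 => /esym/set2P[] Ex.
    by have [_ am _] := P l; rewrite -Ex xm in am.
  by have [] : @inr 'I_1 'I_s m = inr l by rewrite -xm Ex xl.
pose f z := match z with inl l => a l | inr l => x l end.
have fI : injective f.
  case=> l [] m /= E; first by rewrite (pE l m).
  - by have [_ al _] := P l; have [_ _ xm] := P m; rewrite E xm in al.
  - by have [_ am _] := P m; have [_ _ xl] := P l; rewrite -E xl in am.
  have [_ _ xl] := P l; have [_ _ xm] := P m.
  by have [->] : @inr 'I_1 'I_s l = inr m by rewrite -xl E xm.
apply/isomorphicP; exists id, f; apply/and5P; split.
- by apply/bijbP; exists id.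
- by apply/bijbP/(inj_card_bij fI); rewrite card_sum !card_ord Ks; lia.
- by rewrite Ei; apply/eqP; apply: imset0.
- rewrite eqEcard [X in _ && (X <= _)%N]card_Eext_eq.
  rewrite (card_imset _ (imset_inj fI)) (card_Eext_eq (star _)) leqnn andbT.
  apply/subsetP => _ /imsetP[_ /imsetP[l _ ->] ->].
  by rewrite imsetU1 imset_set1 /=; case: (P l).
apply/forallP => -[] l; rewrite map_place_id /place /= ffunE /f -/(place G _).
  by have [_ + _] := P l; case: (place G (a l)) => // v _; rewrite [v]ord1.
by have [_ _ ->] := P l.
Qed.

(** An automorphism fixes the free ends because of their labels, hence it also
   fixes the other ends of the external edges. *)
Lemma symmetry_factor_star (L : finType) : symmetry_factor (star L) = 1%N.
Proof.
apply/eqP/cards1P; exists (finfun id, finfun id); apply/setP => -[f p].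
rewrite !inE; apply/idP/eqP => [|->]; last first.
  rewrite -(eq_is_iso (star L) (star L) (f := id) (g := id)) ?is_iso_id // => z;
  by rewrite ffunE.
case/and5P => _ /bijbP/bij_inj pI _ /eqP Ee /forallP P; rewrite /= in pI.
have pr l : p (inr l) = inr l.
  have := P (inr l); rewrite /place /= ffunE ffunE /=.
  by case: (p (inr l)) => m // /eqP[->].
congr (_, _); apply/ffunP => z; rewrite ffunE; first by rewrite !ord1.
case: z => l; last exact: pr.
have : p @: [set inl l; inr l] \in Eext (star L).
  by rewrite -Ee imset_f //; apply: imset_f.
rewrite imsetU1 imset_set1 pr => /imsetP[m _ /setP E].
have := E (inr l); have := E (p (inl l)); rewrite !inE !eqxx orbT /=.
move=> /esym pl /esym/eqP[lm]; rewrite -lm in pl; case/orP: pl => /eqP // plr.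
by have := pI (inl l) (inr l); rewrite pr plr => /(_ erefl).
Qed.

Lemma biconnected_single (K L : finType) (G : graph 'I_1 K L) : biconnected G.
Proof.
have C F : connected_by G F.
  by apply/forallP => u; apply/forallP => v; rewrite (ord1 u) (ord1 v) connect0.
apply/andP; split; first exact: C.
by apply/forall_inP => e _; apply: C.
Qed.

(** * Linear functionals *)

(** The linear form with value phi x at the basis vector x. *)
Definition pairing (T : choiceType) (phi : T -> rat) (g : {malg rat[T]}) :
  rat := mmap idfun phi g.

Section Pairing.
Variable (T : choiceType) (phi : T -> rat).

Lemma pairingE g : pairing phi g = \sum_(x <- msupp g) g@_x * phi x.
Proof. exact: mmapE. Qed.

Lemma pairingEw (D : {fset T}) (g : {malg rat[T]}) : (msupp g `<=` D)%fset ->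
  pairing phi g = \sum_(x <- D) g@_x * phi x.
Proof. exact: mmapEw. Qed.

Lemma pairing0 : pairing phi 0 = 0.
Proof. exact: mmap0. Qed.

Lemma pairingD g h : pairing phi (g + h) = pairing phi g + pairing phi h.
Proof. exact: mmapD. Qed.

Lemma pairingZ c g : pairing phi (c *: g) = c * pairing phi g.
Proof.
rewrite (pairingEw (msuppZ_le c g)) pairingE mulr_sumr.
by apply: eq_bigr => x _; rewrite mcoeffZ mulrA.
Qed.

Lemma pairing_sum (I : Type) (r : seq I) (P : pred I) (F : I -> {malg rat[T]}) :
  pairing phi (\sum_(i <- r | P i) F i) = \sum_(i <- r | P i) pairing phi (F i).
Proof. exact: raddf_sum. Qed.

Lemma pairingU x : pairing phi << x >> = phi x.
Proof. by rewrite [LHS]mmapU mul1r. Qed.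
End Pairing.

Lemma eq_pairing (T : choiceType) (phi psi : T -> rat) g :
  phi =1 psi -> pairing phi g = pairing psi g.
Proof. by move=> E; apply: eq_bigr => x _; rewrite E. Qed.

Lemma pairing_linext (A B : choiceType) (phi : B -> rat)
    (f : A -> {malg rat[B]}) g :
  pairing phi (linext f g) = pairing (fun x => pairing phi (f x)) g.
Proof. by rewrite pairing_sum; apply: eq_bigr => x _; rewrite pairingZ. Qed.

(** The coefficients of a vector are values of linear forms, so statements on
   coefficients follow from statements on [pairing]. *)
Lemma pairing_indicator (T : choiceType) (y : T) (g : {malg rat[T]}) :
  pairing (fun x => (x == y)%:R) g = g@_y.
Proof.
rewrite (@pairingEw _ _ (y |` msupp g)%fset) ?fsubsetU1 //.
rewrite (big_fsetD1 y) ?fset1U1 //= eqxx mulr1 big_seq big1 ?addr0 // => x.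
by rewrite !inE => /andP[/negPf-> _]; rewrite mulr0.
Qed.

(** * Invariance under isomorphism *)

Definition iso_invariant (n s : nat) (phi : vgraph n s -> rat) :=
  forall x y, isomorphic (grepr x) (grepr y) -> phi x = phi y.

Lemma iso_invariantP (n s : nat) (phi : vgraph n s -> rat) (K K' : finType)
    (G : graph 'I_n K 'I_s) (H : graph 'I_n K' 'I_s) :
  iso_invariant phi -> isomorphic G H -> phi (gclass G) = phi (gclass H).
Proof.
move=> inv GH; apply: inv.
apply: isomorphic_trans (same_isomorphic (gclassK G)) _.
by apply: isomorphic_trans GH _; apply/isomorphic_sym/same_isomorphic/gclassK.
Qed.

Lemma relabel_isomorphic (V K K' L : finType) (g : K -> K') (g' : K' -> K)
    (gK : cancel g g') (g'K : cancel g' g) (G : graph V K L) :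
  isomorphic G (relabel gK g'K G).
Proof. by apply/isomorphicP; exists id, g; apply: relabel_iso. Qed.

Lemma add_edge_iso (V V' K K' L : finType) (u v : V) (G : graph V K L)
    (H : graph V' K' L) f g : is_iso G H f g ->
  isomorphic (add_edge u v G) (add_edge (f u) (f v) H).
Proof.
case/and5P=> bI /bijbP[h gK hK] /eqP Ei /eqP Ee /forallP P.
pose g' (x : K + bool) : K' + bool :=
  match x with inl y => inl (g y) | inr b => inr b end.
have E (X : {set {set K}}) :
    [set g' @: (e : {set K + bool}) | e in old_edges X] =
    old_edges [set g @: (e : {set K}) | e in X].
  rewrite /old_edges -!imset_comp; apply: eq_imset => e /=.
  by rewrite -!imset_comp; apply: eq_imset.
apply/isomorphicP; exists f, g'; apply/and5P; split=> //.
- apply/bijbP; exists (fun x => match x with inl y => inl (h y) | inr b => inr b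
    end); by case=> //= x; rewrite ?gK ?hK.
- by rewrite !Eint_add_edge imsetU1 E imsetU1 imset_set1 Ei.
- by rewrite [Eext (add_edge u v G)]/(old_edges (Eext G)) E Ee.
apply/forallP => -[x|b]; last by rewrite !place_add_edge_new; case: b.
by rewrite !place_add_edge_old.
Qed.

(** The renaming of the vertices after a splitting: the added vertex [ord_max]
   keeps its name. *)
Definition extend_vertex (n : nat) (f : 'I_n -> 'I_n) (v : 'I_n.+1) : 'I_n.+1 :=
  if unlift ord_max v is Some j then old_vertex (f j) else ord_max.

Lemma extend_vertex_max (n : nat) (f : 'I_n -> 'I_n) :
  extend_vertex f ord_max = ord_max.
Proof. by rewrite /extend_vertex unlift_none. Qed.

Lemma extend_vertex_old (n : nat) (f : 'I_n -> 'I_n) j :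
  extend_vertex f (old_vertex j) = old_vertex (f j).
Proof. by rewrite /extend_vertex old_vertexE liftK. Qed.

Lemma split_iso (n : nat) (K K' L : finType) (G : graph 'I_n K L)
    (H : graph 'I_n K' L) f g (D : {set K}) : is_iso G H f g ->
  is_iso (split_vertex D G) (split_vertex (g @: D) H) (extend_vertex f) g.
Proof.
case/and5P=> /bijbP[f' fK f'K] bg Ei Ee /forallP P.
have gI := bij_inj (bijbP _ bg).
have eK (a b : 'I_n -> 'I_n) :
    cancel a b -> cancel (extend_vertex a) (extend_vertex b).
  move=> abK v; case: (vertexP v) => [->|[j ->]].
    by rewrite !extend_vertex_max.
  by rewrite !extend_vertex_old abK.
apply/and5P; split=> //.
  by apply/bijbP; exists (extend_vertex f'); apply: eK.
apply/forallP => x; rewrite !place_split (eqP (P x)) mem_imset //.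
case: (place G x) => //= v.
by case: ifP; rewrite ?extend_vertex_max ?extend_vertex_old.
Qed.

Lemma ends_at_iso (V V' K K' L : finType) (G : graph V K L)
    (H : graph V' K' L) f g v : is_iso G H f g ->
  ends_at H (f v) = g @: ends_at G v.
Proof.
case/and5P=> /bijbP/bij_inj fI /bijbP[g' gK g'K] _ _ /forallP P.
apply/setP => y; rewrite -(g'K y) mem_imset; last exact: can_inj gK.
rewrite !inE (eqP (P _)); case: (place G (g' y)) => //= u.
by apply/eqP/eqP => -[E]; [congr inl; apply: fI|rewrite E].
Qed.

(** Twice the adjoint of [qc_op]: the sum of phi over all ways to split the
   vertex i and to join the two halves by an edge. *)
Definition split_sum_at (n s : nat) (phi : vgraph n.+1 s -> rat) (i : 'I_n)
    (K : finType) (G : graph 'I_n K 'I_s) : rat :=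
  \sum_(D : {set K} |
      (D \subset ends_at G i) && connected (split_vertex D G))
    phi (gclass (add_edge (old_vertex i) ord_max (split_vertex D G))).

Definition split_sum (n s : nat) (phi : vgraph n.+1 s -> rat) (K : finType)
    (G : graph 'I_n K 'I_s) : rat := \sum_(i < n) split_sum_at phi i G.

(** Only the sum over all vertices i is invariant: an isomorphism permutes its
   terms. *)
Lemma split_sum_iso (n s : nat) (phi : vgraph n.+1 s -> rat) (K K' : finType)
    (G : graph 'I_n K 'I_s) (H : graph 'I_n K' 'I_s) :
  iso_invariant phi -> isomorphic G H -> split_sum phi G = split_sum phi H.
Proof.
move=> inv /isomorphicP[f [g P]]; have /and5P[/bijbP bf /bijbP bg _ _ _] := P.
have bgs : bijective (fun D : {set K} => g @: D).
  have [g' gK g'K] := bg; exists (fun D : {set K'} => g' @: D) => D;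
  by rewrite -imset_comp -[RHS]imset_id; apply: eq_imset.
rewrite /split_sum [RHS](reindex f) /=; last exact: onW_bij.
apply: eq_bigr => i _.
rewrite /split_sum_at [RHS](reindex _ (onW_bij _ bgs)) /=.
apply: eq_big => [D|D _].
  congr (_ && _); first rewrite (ends_at_iso _ P).
    apply/idP/idP => [|/subsetP sD]; first exact: imsetS.
    apply/subsetP => x xD; have := sD (g x) (imset_f g xD).
    by rewrite mem_imset //; apply: bij_inj.
  apply: iso_connected; apply/isomorphicP; eexists; eexists.
  exact: split_iso P.
apply: iso_invariantP inv _.
have := add_edge_iso (old_vertex i) ord_max (split_iso D P).
by rewrite extend_vertex_max extend_vertex_old.
Qed.

(** The adjoint of the sum of the operators [t_op]. *)
Definition loop_sum (n s : nat) (phi : vgraph n s -> rat) (K : finType)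
    (G : graph 'I_n K 'I_s) : rat :=
  \sum_(i < n) phi (gclass (add_edge i i G)).

Lemma loop_sum_iso (n s : nat) (phi : vgraph n s -> rat) (K K' : finType)
    (G : graph 'I_n K 'I_s) (H : graph 'I_n K' 'I_s) :
  iso_invariant phi -> isomorphic G H -> loop_sum phi G = loop_sum phi H.
Proof.
move=> inv /isomorphicP[f [g P]]; have /and5P[/bijbP bf _ _ _ _] := P.
rewrite /loop_sum [RHS](reindex f) /=; last exact: onW_bij.
by apply: eq_bigr => i _; apply: iso_invariantP inv _; apply: add_edge_iso P.
Qed.

Lemma pairing_t_op (n s : nat) (phi : vgraph n s -> rat) g :
  \sum_(i < n) pairing phi (t_op i g) =
  pairing (fun x => loop_sum phi (grepr x)) g.
Proof.
rewrite [RHS]pairingE (eq_bigr (fun i => \sum_(x <- msupp g)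
    g@_x * phi (gclass (add_edge i i (grepr x))))).
  by rewrite exchange_big; apply: eq_bigr => x _; rewrite mulr_sumr.
by move=> i _; rewrite pairing_linext; apply: eq_pairing => x; rewrite pairingU.
Qed.

Lemma pairing_sc_graph (n s : nat) (phi : vgraph n.+1 s -> rat) (i : 'I_n)
    (K : finType) (G : graph 'I_n K 'I_s) :
  pairing phi (l_op (old_vertex i) ord_max (sc_graph i G)) =
  split_sum_at phi i G.
Proof.
rewrite pairing_linext /sc_graph pairing_sum /split_sum_at.
(* a distribution is determined by its second component *)
rewrite (reindex_onto (fun D : {set K} => (ends_at G i :\: D, D))
  (fun E => E.2)) /=; last first.
  move=> [E1 E2] /andP[/andP[/= dis /eqP <-] _]; congr (_, _).
  rewrite setDUl setDv setU0; apply/setDidPl; exact: dis.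
apply: eq_big => [D|D _].
  rewrite eqxx andbT /distribution /=; congr (_ && _); apply/andP/idP.
    by case=> _ /eqP <-; apply: subsetUr.
  move=> sD; split; first by rewrite -setI_eq0; apply/eqP/setP => y;
    rewrite !inE; case: (y \in D); rewrite ?andbF.
  apply/eqP/setP => y; rewrite 2!inE; have := subsetP sD y.
  by case: (y \in D) => [/(_ isT)->|_]; rewrite ?orbT ?orbF.
rewrite !pairingU; congr phi; apply/gclass_eq/add_edge_same.
exact: gclassK.
Qed.

Lemma pairing_qc_op (n s : nat) (phi : vgraph n.+1 s -> rat) g :
  \sum_(i < n) pairing phi (qc_op i g) =
  2^-1 * pairing (fun x => split_sum phi (grepr x)) g.
Proof.
rewrite (eq_bigr (fun i => 2^-1 *
  pairing (fun x => split_sum_at phi i (grepr x)) g)).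
  rewrite -mulr_sumr [in LHS]exchange_big; congr (_ * _); apply: eq_bigr => x _.
  by rewrite -mulr_sumr.
move=> i _; rewrite /qc_op pairingZ 2!pairing_linext; congr (_ * _).
by apply: eq_pairing => x; rewrite -pairing_sc_graph pairing_linext.
Qed.

(** * The sum over all biconnected graphs *)

Definition biconn_sum (n s : nat) (phi : vgraph n s -> rat) (K : finType) :
  rat :=
  \sum_(G : graph 'I_n K 'I_s | biconnected G) phi (gclass G).

Lemma biconn_sum_card (n s : nat) (phi : vgraph n s -> rat) (K K' : finType) :
  iso_invariant phi -> #|K| = #|K'| -> biconn_sum phi K = biconn_sum phi K'.
Proof.
move=> inv /eq_card_bij[g [g' gK g'K]]; rewrite /biconn_sum.
rewrite big_mkcond [RHS]big_mkcond [RHS](sum_relabel gK g'K).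
apply: eq_bigr => G _; have I := relabel_isomorphic gK g'K G.
by rewrite (iso_biconnected I) (iso_invariantP inv I).
Qed.

(** The number of internal edges counts the ways to mark one of them. The marked
   edge may be taken to be the new edge of [add_edge]; it is a loop, which gives
   [loop_sum], or it joins two vertices, one of which is [ord_max] after one of
   n + 1 renamings, which gives [split_sum]. *)
Lemma biconn_sum_mark_edge (n s : nat) (phi : vgraph n.+1 s -> rat)
    (K : finType) : iso_invariant phi ->
  \sum_(G : graph 'I_n.+1 (K + bool)%type 'I_s | biconnected G)
     #|Eint G|%:R * phi (gclass G) =
  'C(#|K| + 2, 2)%:R *
    (\sum_(G : graph 'I_n.+1 K 'I_s | biconnected G) loop_sum phi G +
     n.+1%:R * \sum_(G : graph 'I_n K 'I_s | biconnected G) split_sum phi G).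
Proof.
move=> inv; pose F (K : finType) (G : graph 'I_n.+1 K 'I_s) :=
  if biconnected G then phi (gclass G) else 0.
have Finv (K1 K2 : finType) (G : graph 'I_n.+1 K1 'I_s)
    (H : graph 'I_n.+1 K2 'I_s) : isomorphic G H -> F _ G = F _ H.
  by move=> I; rewrite /F (iso_biconnected I) (iso_invariantP inv I).
transitivity (\sum_(G : graph 'I_n.+1 (K + bool)%type 'I_s)
    #|Eint G|%:R * F _ G).
  rewrite big_mkcond; apply: eq_bigr => G _; rewrite /F.
  by case: ifP; rewrite ?mulr0.
rewrite (@sum_card_Eint _ _ _ _ (new_edge K)); first last.
- by move=> g g' gK g'K G; apply/esym/Finv/relabel_isomorphic.
- by rewrite cards2.
rewrite card_sum card_bool sum_new_edge; congr (_ * _).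
(* T u v collects the graphs whose marked edge goes from u to v; by the symmetry
   in the vertices, T u v only depends on whether u = v. *)
pose T u v := \sum_(G : graph 'I_n.+1 K 'I_s) F _ (add_edge u v G).
have Tperm (p : 'I_n.+1 -> 'I_n.+1) u v : bijective p -> T (p u) (p v) = T u v.
  move=> bp; rewrite /T (sum_vmap _ bp); apply: eq_bigr => G _; apply/esym/Finv.
  exact: add_edge_iso (vmap_iso _ bp).
transitivity (\sum_v \sum_u T u v); first by rewrite exchange_big.
rewrite (eq_bigr (fun v => T v v + \sum_(i < n) T (old_vertex i) ord_max)).
  rewrite big_split /= sumr_const card_ord -[X in _ + X]mulr_natl.
  congr (_ + _ * _).
    rewrite exchange_big [RHS]big_mkcond /=; apply: eq_bigr => G _.
    rewrite /F /loop_sum; case: ifP => B.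
      by apply: eq_bigr => v _; rewrite biconnected_add_loop B.
    by rewrite big1 // => v _; rewrite biconnected_add_loop B.
  rewrite [RHS]exchange_big /=; apply: eq_bigr => i _.
  rewrite /T (sum_merge i) [RHS]big_mkcond; apply: eq_bigr => G _.
  rewrite /F /split_sum_at; case: ifP => B.
    rewrite -big_mkcondr; apply: eq_bigl => D.
    case sD: (D \subset _) => //.
    by rewrite biconnected_merge merge_split // B andbT.
  by rewrite big1 // => D sD; rewrite biconnected_merge merge_split // B andbF.
move=> v _; pose p := tperm ord_max v.
have bp : bijective p by apply/injF_bij/perm_inj.
rewrite (reindex p) /=; last exact: onW_bij.
rewrite -[in LHS](tpermL ord_max v) -/p; under eq_bigr do rewrite Tperm //.
by rewrite big_ord_recr /= addrC -[v](tpermL ord_max v) -/p Tperm.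
Qed.

(** * Pairing an invariant function with the recursion *)

Lemma biconn_sum0 (s : nat) (phi : vgraph 0 s -> rat) (K : finType) :
  biconn_sum phi K = 0.
Proof.
by apply: big1 => G _; have /and5P[] := graphP G; rewrite card_ord.
Qed.

Lemma beta0 (s k : nat) : beta s k 0 = 0.
Proof. by case: k. Qed.

Lemma biconn_sum_star (s : nat) (phi : vgraph 1 s -> rat) (K : finType) :
  iso_invariant phi -> #|K| = (2 * s)%N ->
  biconn_sum phi K = phi (gclass (star 'I_s)) * ((#|K|)`!)%:R.
Proof.
move=> inv Ks; rewrite /biconn_sum (eq_bigr (fun=> phi (gclass (star 'I_s)))).
  rewrite sumr_const -[LHS]mulr_natr; congr (_ * _%:R).
  have KS : #|{: 'I_s + 'I_s}| = #|K| by rewrite card_sum card_ord Ks; lia.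
  have := card_isomorphic (star 'I_s) KS.
  rewrite symmetry_factor_star muln1 card_ord (_ : 1`! = 1%N) ?mul1n ?KS //.
  move=> <-.
  apply: eq_card => G; rewrite inE [LHS]biconnected_single.
  by rewrite isomorphic_star.
by move=> G _; apply/esym/(iso_invariantP inv)/isomorphic_star.
Qed.

Lemma pairing_beta_rec (s k n : nat) (phi : vgraph n.+1 s -> rat) :
  pairing phi (beta s k.+1 n.+1) = ((k.+1 + n)%:R)^-1 *
    (2^-1 * pairing (fun x => split_sum phi (grepr x)) (beta s k.+1 n) +
     2^-1 * pairing (fun x => loop_sum phi (grepr x)) (beta s k n.+1)).
Proof.
rewrite beta_rec pairingZ pairingD pairingZ !pairing_sum pairing_qc_op.
by rewrite pairing_t_op addnS subn1.
Qed.

(** By [card_isomorphic] the right-hand side is the sum, over the isomorphism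
   classes of biconnected graphs, of phi divided by the symmetry factor. In this
   form the identity satisfies the recursion: the functions to which the
   induction hypotheses are applied, [split_sum phi] and [loop_sum phi], are
   again invariant. *)
Lemma pairing_beta (s k n : nat) (K : finType) (phi : vgraph n s -> rat) :
  iso_invariant phi -> (#|K| + 2 = 2 * (k + n + s))%N ->
  pairing phi (beta s k n) = biconn_sum phi K / (n`! * (#|K|)`!)%:R.
Proof.
elim: k n K phi => [|k IHk] n; last first.
  elim: n => [|n IHn] K phi inv EK.
    by rewrite beta0 pairing0 biconn_sum0 mul0r.
  pose N := (#|K| - 2)%N.
  have EK' : #|K| = #|{: 'I_N + bool}|.
    by rewrite card_sum card_ord card_bool /N; lia.
  have EN : #|K| = (N + 2)%N by rewrite EK' card_sum card_ord card_bool.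
  have := biconn_sum_mark_edge 'I_N inv.
  rewrite (eq_bigr (fun G => (k.+1 + n)%:R * phi (gclass G))); last first.
    move=> G /andP[C _]; congr (_%:R * _).
    have := card_ends G; rewrite card_Eext_eq -EK' card_ord; lia.
  rewrite -mulr_sumr -/(biconn_sum phi _) -(biconn_sum_card inv EK') card_ord.
  set T := \sum_(G | _) loop_sum _ _; set Q := \sum_(G | _) split_sum _ _.
  move=> E.
  have IHQ : pairing (fun x => split_sum phi (grepr x)) (beta s k.+1 n) =
      Q / (n`! * N`!)%:R.
    rewrite (IHn 'I_N) ?card_ord; last by rewrite /N; lia.
      congr (_ / _); apply: eq_bigr => G _; apply: split_sum_iso => //.
      exact/same_isomorphic/gclassK.
    by move=> x y; apply: split_sum_iso.
  have IHT : pairing (fun x => loop_sum phi (grepr x)) (beta s k n.+1) =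
      T / (n.+1`! * N`!)%:R.
    rewrite (IHk _ 'I_N) ?card_ord; last by rewrite /N; lia.
      congr (_ / _); apply: eq_bigr => G _; apply: loop_sum_iso => //.
      exact/same_isomorphic/gclassK.
    by move=> x y; apply: loop_sum_iso.
  rewrite pairing_beta_rec IHQ IHT EN.
  have kn0 : (k.+1 + n)%:R != 0 :> rat by rewrite pnatr_eq0.
  apply: (mulfI kn0); rewrite mulrA mulfV // mul1r [RHS]mulrA E.
  (* the 2 in 'C(N + 2, 2) = (N + 2)! / (2 N!) cancels the factors 1/2 of both
     operators *)
  have EF : (N + 2)`! = ('C(N + 2, 2) * (2 * N`!))%N.
    by have := bin_fact (leq_addl N 2); rewrite addnK => <-.
  rewrite EF factS; move: (fact_gt0 n) (fact_gt0 N).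
  move: (n`!) (N`!) => nf Nf nf0 Nf0.
  rewrite ![in LHS]natrM ![in RHS]natrM.
  have C0 : 'C(N + 2, 2)%:R != 0 :> rat.
    by rewrite pnatr_eq0 -lt0n bin_gt0 leq_addl.
  have n0 : nf%:R != 0 :> rat by rewrite pnatr_eq0 -lt0n.
  have N0 : Nf%:R != 0 :> rat by rewrite pnatr_eq0 -lt0n.
  have n10 : n.+1%:R != 0 :> rat by rewrite pnatr_eq0.
  move: (n.+1%:R : rat) ('C(N + 2, 2)%:R : rat) (nf%:R : rat) (Nf%:R : rat)
    n10 C0 n0 N0 => a c p q a0 c0 p0 q0.
  by field; rewrite a0 c0 p0 q0.
case: n => [|[|n]] K phi inv EK.
- by rewrite beta0 pairing0 biconn_sum0 mul0r.
- rewrite biconn_sum_star // ?mul1n ?pairingU ?mulfK //; last by lia.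
  by rewrite pnatr_eq0 -lt0n fact_gt0.
rewrite pairing0 /biconn_sum big1 ?mul0r // => G B.
by have := biconnected_card_ends B; lia.
Qed.

(** * Positivity *)

Lemma sumr_gt0 (I : finType) (P : pred I) (F : I -> rat) (i : I) :
  (forall j, P j -> 0 <= F j) -> P i -> 0 < F i -> 0 < \sum_(j | P j) F j.
Proof.
move=> F0 Pi Fi; rewrite (bigD1 i) //=; apply: ltr_wpDr Fi.
by apply: sumr_ge0 => j /andP[Pj _]; apply: F0.
Qed.

Lemma loop_sum_ge0 (n s : nat) (phi : vgraph n s -> rat) (K : finType)
    (G : graph 'I_n K 'I_s) : (forall x, 0 <= phi x) -> 0 <= loop_sum phi G.
Proof. by move=> phi0; apply: sumr_ge0. Qed.

Lemma split_sum_ge0 (n s : nat) (phi : vgraph n.+1 s -> rat) (K : finType)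
    (G : graph 'I_n K 'I_s) : (forall x, 0 <= phi x) -> 0 <= split_sum phi G.
Proof. by move=> phi0; apply: sumr_ge0 => i _; apply: sumr_ge0. Qed.

(** Unlike [loop_sum_iso] and [split_sum_iso], the next two lemmas hold for
   every phi: the names of the vertices are kept. *)
Lemma loop_sum_same (n s : nat) (phi : vgraph n s -> rat) (K K' : finType)
    (G : graph 'I_n K 'I_s) (H : graph 'I_n K' 'I_s) :
  same_upto_ends G H -> loop_sum phi G = loop_sum phi H.
Proof.
by move=> GH; apply: eq_bigr => i _; congr phi; apply/gclass_eq/add_edge_same.
Qed.

Lemma split_sum_same (n s : nat) (phi : vgraph n.+1 s -> rat) (K K' : finType)
    (G : graph 'I_n K 'I_s) (H : graph 'I_n K' 'I_s) :
  same_upto_ends G H -> split_sum phi G = split_sum phi H.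
Proof.
move=> GH; apply: eq_bigr => i _.
by rewrite -!pairing_sc_graph (sc_graph_same i GH).
Qed.

Lemma pairing_beta_ge0 (s k n : nat) (phi : vgraph n s -> rat) :
  (forall x, 0 <= phi x) -> 0 <= pairing phi (beta s k n).
Proof.
elim: k n phi => [|k IHk] n; last first.
  elim: n => [|n IHn] phi phi0; first by rewrite beta0 pairing0.
  rewrite pairing_beta_rec mulr_ge0 ?invr_ge0 ?ler0n // addr_ge0 //.
    by rewrite mulr_ge0 // IHn // => x; apply: split_sum_ge0.
  by rewrite mulr_ge0 // IHk // => x; apply: loop_sum_ge0.
by case: n => [|[|n]] phi phi0 /=; rewrite ?pairing0 ?pairingU.
Qed.

(** The graph G is obtained from a smaller biconnected graph by one of the
   operators, and the corresponding function, [split_sum phi] or [loop_sum phi],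
   is positive at that graph. *)
Lemma pairing_beta_gt0 (s k n : nat) (K : finType) (G : graph 'I_n K 'I_s)
    (phi : vgraph n s -> rat) :
  biconnected G -> (#|K| + 2 = 2 * (k + n + s))%N ->
  (forall x, 0 <= phi x) -> 0 < phi (gclass G) -> 0 < pairing phi (beta s k n).
Proof.
have vertex K' (H : graph 'I_0 K' 'I_s) : False.
  by have /and5P[] := graphP H; rewrite card_ord.
elim: k n K G phi => [|k IHk] n; last first.
  elim: n => [|n IHn] K G phi B EK phi0 phiG; first by case: (vertex _ G).
  rewrite pairing_beta_rec mulr_gt0 ?invr_gt0 ?ltr0n //.
  have split0 x : 0 <= split_sum phi (grepr x) by apply: split_sum_ge0.
  have loop0 x : 0 <= loop_sum phi (grepr x) by apply: loop_sum_ge0.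
  (* with one vertex, k > 0 provides a loop; with several, [ord_max] has a
     neighbour *)
  case: n => [|n] in IHn G phi B EK phi0 phiG split0 loop0 *.
    rewrite ltr_wpDl ?mulr_ge0 ?pairing_beta_ge0 // mulr_gt0 //.
    have : (0 < #|Eint G|)%N.
      by have := card_ends G; rewrite card_Eext_eq card_ord; lia.
    case/card_gt0P => e eG.
    have : adj G (Eint G) ord0 ord0.
      case/and5P: (graphP G) => _ _ _ /forall_inP c2 _.
      have /cards2P[a [b [ab Ee]]] : #|e| == 2%N.
        by apply: c2; rewrite in_setU (eG : e \in dint G).
      apply/exists_inP; exists e => //; apply/exists_inP; exists a.
        by rewrite Ee set21.
      apply/exists_inP; exists b; first by rewrite Ee set22.
      have := int_attached eG (x := a); have := int_attached eG (x := b).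
      rewrite Ee set21 set22 ab => /(_ isT) + /(_ isT).
      by case: (place G a) => // u; case: (place G b) => // v; rewrite !ord1.
    case/adj_edge => a [b [ab abG Ga Gb]].
    have [N [H GH]] := expose_edge ab abG Ga Gb.
    apply: (IHk _ _ H) => //; first exact: biconnected_single.
      by have := same_card_ends GH; lia.
    rewrite (loop_sum_same _ (gclassK H)) /loop_sum big_ord1.
    by rewrite -(proj2 (gclass_eq _ _) GH).
  rewrite ltr_wpDr ?mulr_ge0 ?pairing_beta_ge0 // mulr_gt0 //.
  have /andP[C _] := B; have [i [N [H GH]]] := expose_max_edge C.
  have := iso_biconnected (same_isomorphic GH); rewrite B biconnected_merge.
  move=> /esym/andP[CH BH]; apply: (IHn _ (merge i H)) => //.
    by have := same_card_ends GH; lia.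
  rewrite (split_sum_same _ (gclassK _)); apply: (@sumr_gt0 _ _ _ i) => //.
    by move=> j _; apply: sumr_ge0.
  apply: (@sumr_gt0 _ _ _ (ends_at H ord_max)) => //.
    by rewrite ends_at_merge split_merge.
  by rewrite split_merge -(proj2 (gclass_eq _ _) GH).
case: n => [|[|n]] K G phi B EK phi0 phiG; first by case: (vertex _ G).
  rewrite pairingU; suff <- : gclass G = gclass (star 'I_s) by [].
  have /isomorphicP[f [g P]] : isomorphic G (star 'I_s).
    by apply/isomorphic_sym/isomorphic_star; lia.
  apply/gclass_eq/same_upto_endsP; exists g.
  by rewrite -(eq_is_iso _ _ (f := f) (g := g)) // => v; rewrite !ord1.
by have := biconnected_card_ends B; lia.
Qed.

(** * The coefficients *)

Lemma mem_Vbiconn (n k s : nat) (x : vgraph n s) :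
  (x \in Vbiconn n k s) =
  biconnected (grepr x) && (tag (repr x) + 2 == 2 * (k + n + s))%N.
Proof.
rewrite in_fset inE andbC; case B: (biconnected _) => //=.
rewrite [LHS](in_Vset k x) cyclomatic_connected ?card_ord //.
by case/andP: B.
Qed.

Lemma Vbiconn_iso (n k s : nat) (x y : vgraph n s) :
  isomorphic (grepr x) (grepr y) ->
  (x \in Vbiconn n k s) = (y \in Vbiconn n k s).
Proof.
move=> xy; rewrite !mem_Vbiconn (iso_biconnected xy).
by have := iso_card_ends xy; rewrite !card_ord => ->.
Qed.

(** The indicator of the complement of Vbiconn is invariant and has pairing 0
   with beta; as beta has nonnegative coefficients, they vanish on this
   complement. *)
Lemma msupp_beta (n k s : nat) : (0 < n)%N ->
  (msupp (beta s k n) `<=` Vbiconn n k s)%fset.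
Proof.
move=> n0; apply/fsubsetP => y; apply: contraTT => yV; rewrite -mcoeff_eq0.
pose phi (x : vgraph n s) : rat := (x \notin Vbiconn n k s)%:R.
have phi_inv : iso_invariant phi.
  by move=> x z xz; rewrite /phi (Vbiconn_iso _ xz).
pose N := (2 * (k + n + s) - 2)%N.
have EN : (#|'I_N| + 2 = 2 * (k + n + s))%N by rewrite card_ord /N; lia.
have : pairing phi (beta s k n) = 0.
  rewrite (pairing_beta phi_inv EN) /biconn_sum big1 ?mul0r // => G B.
  rewrite /phi mem_Vbiconn; have I := same_isomorphic (gclassK G).
  rewrite (iso_biconnected I) B /= -EN.
  by have := iso_card_ends I; rewrite !card_ord => ->; rewrite eqxx.
pose psi x := phi x - (x == y)%:R.
have psi0 x : 0 <= psi x.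
  by rewrite /psi /phi; case: eqP => [->|_]; rewrite ?yV ?subrr ?subr0 ?ler0n.
have -> : pairing phi (beta s k n) = pairing psi (beta s k n) + (beta s k n)@_y.
  rewrite -pairing_indicator !pairingE -big_split; apply: eq_bigr => x _ /=.
  by rewrite -mulrDr subrK.
move/eqP; rewrite paddr_eq0 ?pairing_beta_ge0 //; first by case/andP.
by rewrite -pairing_indicator pairing_beta_ge0 // => x; rewrite ler0n.
Qed.

Theorem theorem11 (s n k : nat) (hn : (1 <= n)%N) :
  exists alpha : vgraph n s -> rat,
    [/\ beta s k n = \sum_(G <- Vbiconn n k s) alpha G *: << G >>,
        forall G, G \in Vbiconn n k s -> 0 < alpha G &
        forall C : {fset vgraph n s}, is_iso_class k C ->
        forall G, G \in C ->
          \sum_(H <- C) alpha H = (symmetry_factor (grepr G))%:R^-1].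
Proof.
have sV := msupp_beta k s hn.
exists (fun x => (beta s k n)@_x); split.
- rewrite {1}(monalgEw sV); apply: eq_bigr => x _.
  by apply/malgP => y; rewrite mcoeffZ !mcoeffU mulr_natr.
- move=> x; rewrite mem_Vbiconn => /andP[B /eqP EN].
  rewrite -pairing_indicator; apply: (pairing_beta_gt0 B).
  - by rewrite card_ord.
  - by move=> y; rewrite ler0n.
  by rewrite greprK eqxx.
move=> _ [x xV ->] G GC.
have {GC}[GV xG] : G \in Vbiconn n k s /\ isomorphic (grepr x) (grepr G).
  by apply/andP; move: GC; rewrite in_fset.
pose phi (y : vgraph n s) : rat := (isomorphic (grepr G) (grepr y))%:R.
have phi_inv : iso_invariant phi.
  move=> y z yz; rewrite /phi; congr (nat_of_bool _)%:R; apply/idP/idP => GH.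
    exact: isomorphic_trans GH yz.
  exact: isomorphic_trans GH (isomorphic_sym yz).
have := GV; rewrite mem_Vbiconn => /andP[B /eqP EN].
have EK : (#|'I_(tag (repr G))| + 2 = 2 * (k + n + s))%N by rewrite card_ord.
(* the isomorphism class of G is cut out of the support of beta by phi *)
transitivity (pairing phi (beta s k n)).
  rewrite (pairingEw phi sV) /iso_class big_fset /= big_mkcond /=.
  apply: eq_bigr => y _; rewrite /phi.
  have -> : isomorphic (grepr x) (grepr y) = isomorphic (grepr G) (grepr y).
    by apply/idP/idP; apply: isomorphic_trans => //; apply: isomorphic_sym.
  by case: ifP => _; rewrite ?mulr1 ?mulr0.
rewrite (pairing_beta phi_inv EK) /biconn_sum.
have := @card_isomorphic _ _ _ _ (grepr G) (erefl #|'I_(tag (repr G))|).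
set A := [set H : graph _ _ _ | _] => EA.
have -> : \sum_(H : graph 'I_n 'I_(tag (repr G)) 'I_s | biconnected H)
    phi (gclass H) = #|A|%:R.
  rewrite -sum1_card natr_sum [LHS]big_mkcond [RHS]big_mkcond /=.
  apply: eq_bigr => H _; rewrite inE /phi.
  have -> : isomorphic (grepr G) (grepr (gclass H)) = isomorphic (grepr G) H.
    have I := same_isomorphic (gclassK H); apply/idP/idP => GH.
      exact: isomorphic_trans GH I.
    exact: isomorphic_trans GH (isomorphic_sym I).
  case I: (isomorphic _ H); last by case: ifP.
  by rewrite -(iso_biconnected I) B.
rewrite -[in n`!](card_ord n) -EA natrM invfM mulrA divff ?mul1r //.
rewrite pnatr_eq0 -lt0n.
have : (0 < #|A| * symmetry_factor (grepr G))%N.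
  by rewrite EA muln_gt0 !fact_gt0.
by rewrite muln_gt0 => /andP[].
Qed.
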